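(* Let $p_0,k,r\ge 0$ be integers with $(p_0,k)\neq(1,1)$, let $p_1,q_1,\ldots,p_k,q_k$ be positive integers, and let $G$ be a graph on $n$ vertices whose complement $G^c$ is of the form $$(K_{p_0,0}\cup K_{p_1,q_1}\cup K_{p_2,q_2}\cup\cdots\cup K_{p_k,q_k})\vee K_r.$$ Then for any two nonnegative integers $n_1$ and $n_2$ that satisfy $4+n_1+n_2=n$ there exists a matrix $A\in S(G)$ that has precisely two distinct eigenvalues $\lambda$ and $\mu$, with multiplicities $2+n_1$ and $2+n_2$, respectively.
   Context: Graphs are finite, simple and undirected. For a graph $G$ with vertex set $\{1,\ldots,n\}$, $S(G)$ is the set of all real symmetric $n\times n$ matrices $A=(a_{ij})$ such that, for $i\ne j$, $a_{ij}\neq 0$ if and only if $\{i,j\}$ is an edge of $G$; there is no restriction on the diagonal entries. $K_r$ is the complete graph on $r$ vertices; $K_{p,q}$ is the complete bipartite graph on disjoint sets of cardinality $p$ and $q$; in particular $K_{p,0}$ consists of $p$ isolated vertices. $\cup$ denotes disjoint union of graphs. The join $G\vee H$ is the disjoint union $G\cup H$ together with all possible edges joining vertices of $G$ to vertices of $H$. The complement $G^c$ is the graph on the same vertices in which two distinct vertices are adjacent if and only if they are not adjacent in $G$. When $p_0=0$, $k=0$ or $r=0$ the corresponding parts are absent (empty). *)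

(* Defs.v *)
From mathcomp Require Import all_boot all_order all_algebra.
From mathcomp Require Import reals.

Set Implicit Arguments.
Unset Strict Implicit.
Unset Printing Implicit Defensive.

Import GRing.Theory.

Record sgraph (T : finType) := SGraph {
  adj : rel T;
  adj_sym : symmetric adj;
  adj_irr : irreflexive adj }.

Definition sgraph_iso (T U : finType) (G : sgraph T) (H : sgraph U) : Prop :=
  exists f : T -> U, bijective f /\ forall x y, adj H (f x) (f y) = adj G x y.

Section Complement.
Variables (T : finType) (G : sgraph T).

Definition compl_adj : rel T := fun x y => (x != y) && ~~ adj G x y.

Lemma compl_adj_sym : symmetric compl_adj.
Proof. by move=> x y; rewrite /compl_adj eq_sym adj_sym. Qed.

Lemma compl_adj_irr : irreflexive compl_adj.
Proof. by move=> x; rewrite /compl_adj eqxx. Qed.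

Definition compl : sgraph T := SGraph compl_adj_sym compl_adj_irr.
End Complement.

Section Complete.
Variable r : nat.

Definition complete_adj : rel 'I_r := fun x y => x != y.

Lemma complete_adj_sym : symmetric complete_adj.
Proof. by move=> x y; rewrite /complete_adj eq_sym. Qed.

Lemma complete_adj_irr : irreflexive complete_adj.
Proof. by move=> x; rewrite /complete_adj eqxx. Qed.

Definition complete : sgraph 'I_r := SGraph complete_adj_sym complete_adj_irr.
End Complete.

Section CompleteBipartite.
Variables p q : nat.

Definition cbip_adj : rel ('I_p + 'I_q)%type := fun x y =>
  match x, y with
  | inl _, inr _ | inr _, inl _ => true
  | _, _ => false
  end.

Lemma cbip_adj_sym : symmetric cbip_adj.
Proof. by move=> [x|x] [y|y]. Qed.

Lemma cbip_adj_irr : irreflexive cbip_adj.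
Proof. by move=> [x|x]. Qed.

Definition complete_bipartite : sgraph ('I_p + 'I_q)%type :=
  SGraph cbip_adj_sym cbip_adj_irr.
End CompleteBipartite.

Section UnionJoin.
Variables (T U : finType) (G : sgraph T) (H : sgraph U).

(* The boolean [b] says whether vertices of different parts are adjacent. *)
Definition sum_adj (b : bool) : rel (T + U)%type := fun x y =>
  match x, y with
  | inl x, inl y => adj G x y
  | inr x, inr y => adj H x y
  | _, _ => b
  end.

Lemma sum_adj_sym b : symmetric (sum_adj b).
Proof. by move=> [x|x] [y|y] //=; rewrite adj_sym. Qed.

Lemma sum_adj_irr b : irreflexive (sum_adj b).
Proof. by move=> [x|x] /=; rewrite adj_irr. Qed.

Definition gunion : sgraph (T + U)%type :=
  SGraph (sum_adj_sym false) (sum_adj_irr false).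

Definition gjoin : sgraph (T + U)%type :=
  SGraph (sum_adj_sym true) (sum_adj_irr true).
End UnionJoin.

Section FamilyUnion.
Variables (I : finType) (T : I -> finType) (G : forall i, sgraph (T i)).

(* [tagged_as u v] is [tagged v] transported to the type [T (tag u)], which is
   meaningful since it is used only when [tag u == tag v]. *)
Definition bigunion_adj : rel {i : I & T i} := fun u v =>
  (tag u == tag v) && adj (G (tag u)) (tagged u) (tagged_as u v).

Lemma bigunion_adj_sym : symmetric bigunion_adj.
Proof.
move=> [i x] [j y]; rewrite /bigunion_adj /= [j == i]eq_sym.
case: (i =P j) => //= eij; case: _ / eij y => y.
by rewrite !tagged_asE adj_sym.
Qed.

Lemma bigunion_adj_irr : irreflexive bigunion_adj.
Proof. by move=> [i x]; rewrite /bigunion_adj tagged_asE adj_irr andbF. Qed.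

Definition gbigunion : sgraph {i : I & T i} :=
  SGraph bigunion_adj_sym bigunion_adj_irr.
End FamilyUnion.

Local Open Scope ring_scope.

Definition in_S (R : realType) (n : nat) (G : sgraph 'I_n) (A : 'M[R]_n) :
  Prop := A^T = A /\ forall i j, i != j -> (A i j != 0) = adj G i j.

(* Geometric multiplicity; it agrees with the algebraic one for the symmetric
   matrices considered here. MathComp's [eigenspace] consists of row
   eigenvectors. *)
Definition eigen_mult (R : realType) (n : nat) (A : 'M[R]_n) (a : R) : nat :=
  \rank (eigenspace A a).

(* Main.v *)
Require Import Defs.
From mathcomp Require Import all_boot all_order all_algebra.
From mathcomp Require Import reals.
From mathcomp Require Import ring lra zify.

Set Implicit Arguments.
Unset Strict Implicit.
Unset Printing Implicit Defensive.

Import Order.TTheory GRing.Theory Num.Theory.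

Local Open Scope ring_scope.

(** The graph [G] is the disjoint union of [r] isolated vertices and of a graph [H],
    the join of a clique on [p0] vertices with the disjoint unions of two cliques
    of orders [p i] and [q i].  A symmetric matrix with the two eigenvalues [1] and
    [0] is an orthogonal projection, so the theorem asks for a projection with the
    off-diagonal pattern of [G] and any rank [s] from [2] to [n - 2]
    ([classes_realize]); replacing [P] by [1 - P] exchanges [s] and [n - s].

    Vertices of the same clique are twins.  A twin of a vertex [x], or an isolated
    vertex, can be added to a projection while adding [0] or [1] to the rank, as we
    like: rotate a new eigenvalue [0] or [1] into the coordinate [x] ([add_twin]).
    Hence it suffices to realize suitable ranks on a few vertices of each clique
    ([saturate]).  If [H] is a disjoint union of at most
    two cliques this is immediate ([cluster_realizes]), and if [k = 1] and
    [p0 >= 2] it starts from an explicit projection of rank [2] on four vertices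
    ([base_double_cone]).

    There remains the case of [k >= 2] nonadjacent pairs [a i], [b i], all other
    vertices being adjacent, with at most one apex [z] adjacent to all of them.
    The ranks [2] to [k] are enough, by complementation.  Two moves add a pair:
    - [join_pair] adds one to the rank.  Given unit vectors [u] in the kernel and [w]
      in the image with [u_i u_j = w_i w_j] at nonadjacent [i], [j], one rotates
      [u] into a new coordinate [a] of eigenvalue [1], and [w] into a new coordinate
      [b] of eigenvalue [0], by the same angle.  The entry at [a], [b] stays zero
      because [a] and [b] are mixed with different vectors, the old zeros are kept
      because the changes made by [u] and [w] cancel there, and two vectors of the
      same kind exist for the new projection.
    - [split_pair] keeps the rank.  It divides a pair with equal diagonal entries
      into two pairs, by adding a twin to both of its vertices and rotating the plane
      of these twins.
    They start from explicit projections of rank [2] on two or three pairs, with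
    or without an apex.  In rank [2] a projection is the Gram matrix of a Parseval
    frame of the plane, and nonadjacent vertices are those with orthogonal vectors;
    there [u] is obtained from [w] by changing signs.

    All nonzero entries are kept nonzero by a generic choice of the angles
    ([avoid_affine]). *)

(** * Values avoided by a parameter *)

Section Avoidance.
Variable R : realFieldType.

Lemma avoid_finite (E : seq R) : exists2 t : R, 0 < t < 1 & t \notin E.
Proof.
pose F := [seq ((i.+2)%:R : R)^-1 | i <- iota 0 (size E).+1].
have uF : uniq F.
  rewrite map_inj_uniq ?iota_uniq // => i j /invr_inj /eqP.
  by rewrite eqr_nat => /eqP [].
case: (boolP (all (mem E) F)) => [/allP sFE | /allPn [t /mapP [i _ ->] tE]].
  by have := uniq_leq_size uF sFE; rewrite size_map size_iota ltnn.
exists (i.+2%:R^-1) => //.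
by rewrite invr_gt0 ltr0n invf_lt1 ?ltr0n // ltr1n.
Qed.

(** Each affine function with a nonzero constant term excludes at most one
    value of [t].  It is the only genericity used below: a construction that
    depends on a parameter keeps finitely many entries nonzero as soon as they
    are affine in the parameter and nonzero at [0]. *)
Lemma avoid_affine (I : finType) (f g : I -> R) :
  exists2 t : R, 0 < t < 1 & forall i, f i != 0 -> f i + t * g i != 0.
Proof.
have [t t01 tE] := avoid_finite [seq - (f i / g i) | i <- enum I].
exists t => // i fi0; apply: contra tE => /eqP fg0; apply/mapP; exists i.
  by rewrite mem_enum.
have gi0 : g i != 0.
  by apply: contra fi0 => /eqP g0; rewrite -fg0 g0 mulr0 addr0.
apply: (mulIf gi0); rewrite mulNr divfK // -[f i]addr0.
by rewrite -[in RHS](subrr (t * g i)) addrA fg0 sub0r opprK.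
Qed.
End Avoidance.

(** * Orthogonal projections *)

Section Projections.
Variables (R : realType) (n : nat).
Implicit Types (P : 'M[R]_n) (u v w g : 'cV[R]_n).

Definition dot u v : R := (u^T *m v) 0 0.

Lemma dotE u v : dot u v = \sum_i u i 0 * v i 0.
Proof. by rewrite /dot mxE; apply: eq_bigr => i _; rewrite mxE. Qed.

Lemma dotC u v : dot u v = dot v u.
Proof. by rewrite !dotE; apply: eq_bigr => i _; rewrite mulrC. Qed.

Lemma dotDl u v w : dot (u + v) w = dot u w + dot v w.
Proof. by rewrite /dot linearD /= mulmxDl mxE. Qed.

Lemma dotZl a u w : dot (a *: u) w = a * dot u w.
Proof. by rewrite /dot linearZ /= -scalemxAl mxE. Qed.

Lemma dotDr u v w : dot w (u + v) = dot w u + dot w v.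
Proof. by rewrite ![dot w _]dotC dotDl. Qed.

Lemma dotZr a u w : dot w (a *: u) = a * dot w u.
Proof. by rewrite ![dot w _]dotC dotZl. Qed.

Lemma dot_delta a u : dot (delta_mx a 0) u = u a 0.
Proof.
rewrite dotE (bigD1 a) //= big1 ?addr0 => [|i ia].
  by rewrite mxE !eqxx mul1r.
by rewrite mxE (negbTE ia) mul0r.
Qed.

Definition dot_lin := (dotDl, dotDr, dotZl, dotZr).

Lemma trmulE u v : u^T *m v = (dot u v)%:M.
Proof. exact: mx11_scalar. Qed.

Lemma outer_mul g v : (g *m g^T) *m v = dot g v *: g.
Proof. by rewrite -mulmxA trmulE mul_mx_scalar. Qed.

(** The rank of an orthogonal projection is recorded through the trace, which,
    unlike the rank, is visibly additive and invariant under conjugation. *)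
Definition proj P (s : nat) := [/\ P^T = P, P *m P = P & \tr P = s%:R].

Lemma outerE g i j : (g *m g^T) i j = g i 0 * g j 0.
Proof. by rewrite mxE big_ord1 mxE. Qed.

Lemma tr_outer g : (g *m g^T)^T = g *m g^T.
Proof. by rewrite trmx_mul trmxK. Qed.

Lemma mxtrace_outer g : \tr (g *m g^T) = dot g g.
Proof. by rewrite mxtrace_mulC trmulE mxtrace_scalar mulr1n. Qed.

Lemma proj_dot P s u w : proj P s -> P *m u = 0 -> P *m w = w -> dot u w = 0.
Proof.
case=> sP _ _ Pu Pw; rewrite /dot -Pw mulmxA.
by rewrite -[u^T *m P]trmxK trmx_mul trmxK sP Pu trmx0 mul0mx mxE.
Qed.

Lemma proj0 : proj 0 0.
Proof. by split; rewrite ?trmx0 ?mulmx0 ?mxtrace0. Qed.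

Lemma proj_add P s g : proj P s -> P *m g = 0 -> dot g g = 1 ->
  proj (P + g *m g^T) s.+1.
Proof.
move=> [sP iP tP] Pg gg; have gP : g^T *m P = 0.
  by rewrite -[_ *m P]trmxK trmx_mul trmxK sP Pg trmx0.
split; first by rewrite linearD /= sP tr_outer.
  rewrite mulmxDl !mulmxDr iP mulmxA Pg mul0mx addr0 -mulmxA gP mulmx0 add0r.
  by rewrite mulmxA outer_mul gg scale1r.
by rewrite linearD /= tP mxtrace_outer gg -natr1.
Qed.

Lemma proj_sub P s g : proj P s.+1 -> P *m g = g -> dot g g = 1 ->
  proj (P - g *m g^T) s.
Proof.
move=> [sP iP tP] Pg gg; have gP : g^T *m P = g^T.
  by rewrite -[_ *m P]trmxK trmx_mul trmxK sP Pg.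
split; first by rewrite linearB /= sP tr_outer.
  rewrite mulmxBl !mulmxBr iP mulmxA Pg -mulmxA gP.
  by rewrite mulmxA outer_mul gg scale1r subrr subr0.
by rewrite linearB /= tP mxtrace_outer gg -natr1 addrK.
Qed.

Lemma proj_compl P s : (s <= n)%N -> proj P s -> proj (1%:M - P) (n - s).
Proof.
move=> sn [sP iP tP]; split; first by rewrite linearB /= trmx1 sP.
  by rewrite mulmxBl mul1mx mulmxBr mulmx1 iP subrr subr0.
by rewrite linearB /= mxtrace1 tP natrB.
Qed.

(** In a rank factorisation [L *m U] of an idempotent the factors satisfy
    [U *m L = 1], so that the trace counts the rank. *)
Lemma mxrank_idem P : P *m P = P -> (\rank P)%:R = \tr P.
Proof.
have /row_freeP [C] := row_base_free P; have /row_fullP [B] := col_base_full P.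
have := mulmx_base P.
move: (row_base P) (col_base P) => U L PE BL UC iP.
suff UL : U *m L = 1%:M by rewrite -[in RHS]PE mxtrace_mulC UL mxtrace1.
have : B *m (L *m U *m (L *m U)) *m C = B *m (L *m U) *m C by rewrite PE iP.
rewrite !mulmxA BL mul1mx -!mulmxA UC !mulmx1 => ->; exact: erefl.
Qed.

Lemma mxrank_proj P s : proj P s -> \rank P = s.
Proof.
by case=> _ iP tP; apply/eqP; rewrite -(eqr_nat R) mxrank_idem // tP.
Qed.
End Projections.

(** * Adding two vertices and one dimension *)

Section Join.
Variables (R : realType) (n : nat) (e : rel 'I_n).
Hypotheses (e_sym : symmetric e) (e_irr : irreflexive e).
Implicit Types (P : 'M[R]_n) (u w g : 'cV[R]_n) (A : {set 'I_n}).

(** All graphs are induced subgraphs of one graph [e] on ['I_n], given by their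
    vertex set [A]; the matrices vanish outside [A].  Growing a graph is then
    growing [A], without any change of index type. *)
Record realizes A P (s : nat) : Prop := Realizes {
  real_proj : proj P s;
  real_supp : forall i j, i \notin A -> P i j = 0;
  real_adj : {in A &, forall i j, i != j -> (P i j != 0) = e i j} }.

Lemma proj_sym P s i j : proj P s -> P i j = P j i.
Proof. by case=> sP _ _; rewrite -[in LHS]sP mxE. Qed.

(** The data needed to add a pair of vertices [a], [b] with [join_pair]: the new
    column of [a] is a multiple of [u] and that of [b] a multiple of [w], whence
    the full supports, and the old block changes by a multiple of
    [u *m u^T - w *m w^T], whence the equality at nonadjacent pairs. *)
Record balanced A P u w : Prop := Balanced {
  bal_ker : P *m u = 0;
  bal_im : P *m w = w;
  bal_ker1 : dot u u = 1;
  bal_im1 : dot w w = 1;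
  bal_ker_supp : forall i, (u i 0 != 0) = (i \in A);
  bal_im_supp : forall i, (w i 0 != 0) = (i \in A);
  bal_eq : {in A &, forall i j, i != j -> ~~ e i j ->
              u i 0 * u j 0 = w i 0 * w j 0} }.

Lemma mulmx_delta0 A P s a : realizes A P s -> a \notin A ->
  P *m delta_mx a 0 = 0 :> 'cV_n.
Proof.
move=> rP aA; apply/matrixP => i j; rewrite ord1 !mxE (bigD1 a) //= big1.
  by rewrite (proj_sym i a (real_proj rP)) (real_supp rP) // mul0r addr0.
by move=> k ka; rewrite mxE (negbTE ka) mulr0.
Qed.

(** Start from the projection on the image of [P] plus the vector [ea], and
    rotate by the same angle in the planes of [ea], [u] and of [w], [eb]: the unit
    vector [w] of the image is replaced by the orthonormal vectors
    [g = c ea + q u] and [h = c w + q eb].  Since [a] is only mixed with [u] and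
    [b] only with [w], the entry at [a], [b] stays zero; the change of the old block is
    [t (u u^T - w w^T)] with [t = q^2], which vanishes at nonadjacent pairs.

    Repeated use is possible because equal angles give a new balanced pair:
    [w' = q g - c h] and [u' = c (c u - q ea) + q (c eb - q w)] satisfy
    [u' u'^T - w' w'^T = (1 - 2 t) (u u^T - w w^T)] on the old block, the mixed
    terms in [u] and [w] cancelling.

    The last clause says that positions where [u] and [w] agree up to sign keep their
    diagonal entry: it is used to preserve the hypothesis of [split_pair]. *)
Lemma join_pair A P s u w a b : realizes A P s -> balanced A P u w ->
    a != b -> ~~ e a b -> {in A, forall v, e a v && e b v} ->
  exists P' u' w', [/\ realizes (a |: (b |: A)) P' s.+1,
    balanced (a |: (b |: A)) P' u' w' &
    {in A, forall i, u i 0 ^+ 2 = w i 0 ^+ 2 ->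
       P' i i = P i i /\ u' i 0 ^+ 2 = w' i 0 ^+ 2}].
Proof.
move=> rP bP ab nab abA.
have aA : a \notin A by apply/negP => /abA; rewrite e_irr.
have bA : b \notin A by apply/negP => /abA; rewrite e_irr andbF.
(* w is a nonzero vector of the image, so the rank is positive *)
case: s rP => [|s] rP.
  have P0 : P = 0.
    by apply/eqP; rewrite -mxrank_eq0 (mxrank_proj (real_proj rP)).
  have /eqP := bal_im1 bP.
  rewrite -(bal_im bP) P0 mul0mx dotE big1 ?(eq_sym 0) ?oner_eq0 // => i _.
  by rewrite mxE mul0r.
(* the entries of the old block, of u' and of w' that have to stay nonzero *)
pose I := ('I_n * 'I_n + ('I_n + 'I_n))%type.
pose f (i : I) := match i with
  | inl (i, j) => P i j | inr (inl i) => u i 0 | inr (inr i) => - w i 0 end.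
pose d (i : I) := match i with
  | inl (i, j) => u i 0 * u j 0 - w i 0 * w j 0
  | inr (inl i) => - (u i 0 + w i 0) | inr (inr i) => u i 0 + w i 0 end.
have [t /andP [t0 t1] tE] := avoid_affine f d.
pose c := Num.sqrt (1 - t); pose q := Num.sqrt t.
have cc : c * c = 1 - t by rewrite -expr2 sqr_sqrtr // subr_ge0 ltW.
have qq : q * q = t by rewrite -expr2 sqr_sqrtr // ltW.
have c0 : c != 0 by rewrite sqrtr_eq0 -ltNge subr_gt0.
have q0 : q != 0 by rewrite sqrtr_eq0 -ltNge.
have ua : u a 0 = 0 by apply/eqP; rewrite -[_ == _]negbK (bal_ker_supp bP).
have ub : u b 0 = 0 by apply/eqP; rewrite -[_ == _]negbK (bal_ker_supp bP).
have wa : w a 0 = 0 by apply/eqP; rewrite -[_ == _]negbK (bal_im_supp bP).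
have wb : w b 0 = 0 by apply/eqP; rewrite -[_ == _]negbK (bal_im_supp bP).
have uw : dot u w = 0 := proj_dot (real_proj rP) (bal_ker bP) (bal_im bP).
have wu : dot w u = 0 by rewrite dotC.
have Pa := mulmx_delta0 rP aA; have Pb := mulmx_delta0 rP bA.
have [uu ww] := (bal_ker1 bP, bal_im1 bP).
have aab : (a == b) = false := negbTE ab.
have bba : (b == a) = false by rewrite eq_sym.
pose ea : 'cV[R]_n := delta_mx a 0; pose eb : 'cV[R]_n := delta_mx b 0.
have dots : (dot ea ea = 1) * (dot eb eb = 1) * (dot ea eb = 0) *
    (dot eb ea = 0) * (dot ea u = 0) * (dot ea w = 0) * (dot eb u = 0) *
    (dot eb w = 0) * (dot u ea = 0) * (dot w ea = 0) * (dot u eb = 0) *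
    (dot w eb = 0).
  rewrite ![dot u _]dotC ![dot w _]dotC !dot_delta ua ub wa wb.
  by rewrite !mxE !eqxx aab bba.
pose g := c *: ea + q *: u.
pose h := c *: w + q *: eb.
pose P1 := P - w *m w^T.
have pP1 : proj P1 s := proj_sub (real_proj rP) (bal_im bP) ww.
have P1v (v : 'cV_n) : P1 *m v = P *m v - dot w v *: w by rewrite mulmxBl outer_mul.
pose P2 := P1 + g *m g^T.
have P1g : P1 *m g = 0.
  rewrite P1v /g mulmxDr -!scalemxAr Pa (bal_ker bP) !dot_lin !dots wu.
  by rewrite !(mulr0, scaler0, addr0, scale0r, subr0).
have gg : dot g g = 1 by rewrite /g !dot_lin !dots uu; lra.
have pP2 : proj P2 s.+1 := proj_add pP1 P1g gg.
have P2v (v : 'cV_n) : P2 *m v = P1 *m v + dot g v *: g by rewrite mulmxDl outer_mul.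
have gh : dot g h = 0 by rewrite /g /h !dot_lin !dots uw; lra.
have P2h : P2 *m h = 0.
  rewrite P2v gh scale0r addr0 P1v /h mulmxDr -!scalemxAr Pb (bal_im bP).
  by rewrite !dot_lin !dots ww mulr1 mulr0 scaler0 !addr0 subrr.
have hh : dot h h = 1 by rewrite /h !dot_lin !dots ww; lra.
pose P3 := P2 + h *m h^T.
have pP3 : proj P3 s.+2 := proj_add pP2 P2h hh.
have P3v (v : 'cV_n) : P3 *m v = P2 *m v + dot h v *: h by rewrite mulmxDl outer_mul.
pose u' := c *: (c *: u - q *: ea) + q *: (c *: eb - q *: w).
pose w' := q *: g - c *: h.
have gi i : g i 0 = c * (i == a)%:R + q * u i 0 by rewrite !mxE eqxx andbT.
have hi i : h i 0 = c * w i 0 + q * (i == b)%:R by rewrite !mxE eqxx andbT.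
have u'i i : u' i 0 = c * (c * u i 0 - q * (i == a)%:R)
     + q * (c * (i == b)%:R - q * w i 0) by rewrite !mxE eqxx !andbT.
have w'i i : w' i 0 = q * g i 0 - c * h i 0 by rewrite !mxE eqxx !andbT.
have P3E i j : P3 i j = P i j - w i 0 * w j 0 + g i 0 * g j 0 + h i 0 * h j 0.
  by rewrite !mxE !big_ord1 !mxE.
have Aa i : i \in A -> (i == a) = false by move=> iA; apply: contraNF aA => /eqP <-.
have Ab i : i \in A -> (i == b) = false by move=> iA; apply: contraNF bA => /eqP <-.
have P3A i j : i \in A -> j \in A ->
    P3 i j = P i j + t * (u i 0 * u j 0 - w i 0 * w j 0).
  by move=> iA jA; rewrite P3E !gi !hi !Aa ?Ab // !mulr0 /=; ring: cc qq.
have u'A i : i \in A -> u' i 0 = u i 0 + t * - (u i 0 + w i 0).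
  by move=> iA; rewrite u'i Aa ?Ab // /=; ring: cc qq.
have w'A i : i \in A -> w' i 0 = - w i 0 + t * (u i 0 + w i 0).
  by move=> iA; rewrite w'i gi hi Aa ?Ab // /=; ring: cc qq.
have u'a : u' a 0 = - (c * q) by rewrite u'i eqxx aab ua wa /=; ring.
have u'b : u' b 0 = c * q by rewrite u'i eqxx bba ub wb /=; ring.
have w'a : w' a 0 = c * q by rewrite w'i gi hi eqxx aab ua wa /=; ring.
have w'b : w' b 0 = - (c * q) by rewrite w'i gi hi eqxx bba ub wb /=; ring.
have out i : i \notin a |: (b |: A) ->
    [/\ (i == a) = false, (i == b) = false & i \notin A].
  by rewrite !inE !negb_or => /and3P [/negbTE -> /negbTE -> ->].
have outu i : i \notin A -> u i 0 = 0.
  by move=> iA; apply/eqP; rewrite -[_ == _]negbK (bal_ker_supp bP).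
have outw i : i \notin A -> w i 0 = 0.
  by move=> iA; apply/eqP; rewrite -[_ == _]negbK (bal_im_supp bP).
have wu' : dot w u' = - (q * q) by rewrite /u' -!scaleN1r !dot_lin !dots wu ww; ring.
have gu' : dot g u' = 0 by rewrite /u' /g -!scaleN1r !dot_lin !dots uu uw; ring: cc qq.
have hu' : dot h u' = 0 by rewrite /u' /h -!scaleN1r !dot_lin !dots ww wu; ring: cc qq.
have Pu' : P *m u' = - (q * q) *: w.
  rewrite /u' mulmxDr -!scalemxAr !mulmxBr -!scalemxAr (bal_ker bP) (bal_im bP) Pa Pb.
  by rewrite !scaler0 subrr scaler0 add0r sub0r scalerN scalerA scaleNr.
have ww' : dot w w' = - (c * c).
  by rewrite /w' /g /h -!scaleN1r !dot_lin !dots wu ww; ring.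
have hg : dot h g = 0 by rewrite dotC.
have gw' : dot g w' = q.
  by rewrite /w' -scaleN1r dotDr !dotZr gg gh; ring.
have hw' : dot h w' = - c.
  by rewrite /w' -scaleN1r dotDr !dotZr hg hh; ring.
have Pw' : P *m w' = - (c * c) *: w.
  rewrite /w' /g /h mulmxBr -!scalemxAr !mulmxDr -!scalemxAr.
  rewrite (bal_ker bP) (bal_im bP) Pa Pb.
  by rewrite !(scaler0, addr0) sub0r scalerA scaleNr.
exists P3, u', w'; split.
- split=> //.
    move=> i j /out [ia ib iA].
    by rewrite P3E gi hi ia ib (outu i) // (outw i) // (real_supp rP) // /=; ring.
  have P3ab : P3 a b = 0.
    by rewrite P3E !gi !hi eqxx aab bba (real_supp rP) // ua wa ub wb /=; ring.
  have P3a i : i \in A -> P3 a i = c * q * u i 0.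
    move=> iA; rewrite P3E !gi !hi eqxx aab Aa ?Ab // (real_supp rP) // ua wa /=; ring.
  have P3b i : i \in A -> P3 b i = c * q * w i 0.
    move=> iA; rewrite P3E !gi !hi eqxx bba Aa ?Ab // (real_supp rP) // ub wb /=; ring.
  have P3na i : i \in A -> (P3 a i != 0) = e a i.
    move=> iA; rewrite P3a // !mulf_eq0 (negbTE c0) (negbTE q0) (bal_ker_supp bP).
    by have /andP [-> _] := abA _ iA.
  have P3nb i : i \in A -> (P3 b i != 0) = e b i.
    move=> iA; rewrite P3b // !mulf_eq0 (negbTE c0) (negbTE q0) (bal_im_supp bP).
    by have /andP [_ ->] := abA _ iA.
  have P3s := proj_sym _ _ pP3.
  move=> i j; rewrite !inE.
  case/or3P => [/eqP -> | /eqP -> | iA]; case/or3P => [/eqP -> | /eqP -> | jA] //;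
    rewrite ?eqxx //.
  + by rewrite P3ab eqxx (negbTE nab).
  + by move=> _; apply: P3na.
  + by rewrite P3s P3ab eqxx e_sym (negbTE nab).
  + by move=> _; apply: P3nb.
  + by move=> _; rewrite P3s e_sym; apply: P3na.
  + by move=> _; rewrite P3s e_sym; apply: P3nb.
  + move=> ij; rewrite -(real_adj rP) // P3A //.
    case: (boolP (e i j)) => eij.
      have Pij : P i j != 0 by rewrite (real_adj rP).
      by rewrite Pij (tE (inl (i, j))).
    rewrite (bal_eq bP) // subrr mulr0 addr0 //.
- split.
  + by rewrite P3v P2v P1v Pu' wu' gu' hu' subrr !scale0r !addr0.
  + rewrite P3v P2v P1v gw' hw' Pw' ww' subrr scaleNr add0r; exact: erefl.
  + rewrite /u' -!scaleN1r !dot_lin !dots uu ww uw wu; ring: cc qq.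
  + rewrite /w' /g /h -!scaleN1r !dot_lin !dots uu ww uw wu; ring: cc qq.
  + move=> i; rewrite !inE; case: (boolP (i == a)) => [/eqP -> | ia].
      by rewrite u'a oppr_eq0 mulf_neq0.
    case: (boolP (i == b)) => [/eqP -> | ib]; first by rewrite u'b mulf_neq0.
    case: (boolP (i \in A)) => iA /=.
      by rewrite u'A // (tE (inr (inl i))) // (bal_ker_supp bP).
    by rewrite u'i (negbTE ia) (negbTE ib) outu ?outw // !(mulr0, subrr, addr0) eqxx.
  + move=> i; rewrite !inE; case: (boolP (i == a)) => [/eqP -> | ia].
      by rewrite w'a mulf_neq0.
    case: (boolP (i == b)) => [/eqP -> | ib]; first by rewrite w'b oppr_eq0 mulf_neq0.
    case: (boolP (i \in A)) => iA /=.
      by rewrite w'A // (tE (inr (inr i))) // /f oppr_eq0 (bal_im_supp bP).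
    rewrite w'i gi hi (negbTE ia) (negbTE ib) outu ?outw //.
    by rewrite !(mulr0, subrr, addr0) eqxx.
  + have u'w'ab : u' a 0 * u' b 0 = w' a 0 * w' b 0 by rewrite u'a u'b w'a w'b; ring.
    move=> i j; rewrite !inE.
    case/or3P => [/eqP -> | /eqP -> | iA]; case/or3P => [/eqP -> | /eqP -> | jA] //;
    rewrite ?eqxx //.
    * by move=> _; have /andP [-> _] := abA _ jA.
    * by move=> _ _; rewrite mulrC u'w'ab mulrC.
    * by move=> _; have /andP [_ ->] := abA _ jA.
    * by move=> _; have /andP [+ _] := abA _ iA; rewrite e_sym => ->.
    * by move=> _; have /andP [_ +] := abA _ iA; rewrite e_sym => ->.
    * move=> ij eij; have uwij := bal_eq bP iA jA ij eij.
      apply/eqP; rewrite -subr_eq0; apply/eqP.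
      have -> : u' i 0 * u' j 0 - w' i 0 * w' j 0 =
         (1 - t - t) * (u i 0 * u j 0 - w i 0 * w j 0).
        by rewrite !u'A ?w'A //; ring.
      by rewrite uwij subrr mulr0.
- move=> i iA uw2; split; first by rewrite P3A // -!expr2 uw2 subrr mulr0 addr0.
  have -> : u' i 0 ^+ 2 = w' i 0 ^+ 2 + (1 - t - t) * (u i 0 ^+ 2 - w i 0 ^+ 2).
    by rewrite u'A // w'A //; ring.
  by rewrite uw2 subrr mulr0 addr0.
Qed.
End Join.

(** * Plane rotations *)

Section Rotation.
Variables (R : realType) (n : nat).
Implicit Types (P G : 'M[R]_n) (x y : 'I_n) (c s : R) (f : 'I_n -> R).

Lemma proj_conj G P r : G *m G^T = 1%:M -> proj P r -> proj (G *m P *m G^T) r.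
Proof.
move=> GG [sP iP tP]; have GG' := mulmx1C GG.
split; first by rewrite !trmx_mul trmxK sP mulmxA.
  by rewrite !mulmxA -[_ *m G^T *m G]mulmxA GG' mulmx1 -[_ *m P *m P]mulmxA iP.
by rewrite mxtrace_mulC mulmxA GG' mul1mx.
Qed.

Lemma unit_circle_point :
  exists c s : R, [/\ c != 0, s != 0 & c * c + s * s = 1].
Proof.
exists (3%:R / 5%:R), (4%:R / 5%:R).
by split; [apply/eqP; lra | apply/eqP; lra | field].
Qed.

Definition rot x y c s f i :=
  if i == x then c * f x - s * f y
  else if i == y then s * f x + c * f y else f i.

Definition rot_mx x y c s : 'M[R]_n :=
  \matrix_(i, j) rot x y c s (fun k => (k == j)%:R) i.

Lemma sum_indicator x f : \sum_k (x == k)%:R * f k = f x.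
Proof.
rewrite (bigD1 x) //= eqxx mul1r big1 ?addr0 // => k kx.
by rewrite eq_sym (negbTE kx) mul0r.
Qed.

Lemma rot_mxE x y c s m (M : 'M_(n, m)) i j :
  (rot_mx x y c s *m M) i j = rot x y c s (fun k => M k j) i.
Proof.
rewrite mxE /rot; under eq_bigr do rewrite mxE.
case: ifP => ix.
  under eq_bigr do rewrite /rot ix mulrBl -!mulrA.
  by rewrite sumrB -!mulr_sumr !sum_indicator.
case: ifP => iy.
  under eq_bigr do rewrite /rot ix iy mulrDl -!mulrA.
  by rewrite big_split /= -!mulr_sumr !sum_indicator.
by under eq_bigr do rewrite /rot ix iy; rewrite sum_indicator.
Qed.

Lemma rot_mx_orth x y c s : x != y -> c * c + s * s = 1 ->
  rot_mx x y c s *m (rot_mx x y c s)^T = 1%:M.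
Proof.
move=> xy cs; apply/matrixP => i j; rewrite rot_mxE /rot !mxE /rot.
have yx : (y == x) = false by rewrite eq_sym (negbTE xy).
have simp := (eqxx, yx, negbTE xy).
have ne (k l : 'I_n) : k != l -> (l == k) = false by rewrite eq_sym => /negbTE.
case: (eqVneq i x) => [? | ix]; case: (eqVneq j x) => [? | jx].
- by subst; rewrite ?simp /=; apply: etrans cs; ring.
- case: (eqVneq j y) => [? | jy]; subst; rewrite ?simp /=; first by ring.
  by rewrite ?(ne j) //=; ring.
- case: (eqVneq i y) => [? | iy]; subst; rewrite ?simp /=; first by ring.
  by rewrite ?(ne i) // ?(negbTE ix) /=; ring.
- case: (eqVneq i y) => [? | iy]; case: (eqVneq j y) => [? | jy].
  + by subst; rewrite ?simp /=; apply: etrans cs; ring.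
  + by subst; rewrite ?simp ?(ne j) //=; ring.
  + by subst; rewrite ?simp ?(ne i) // ?(negbTE iy) /=; ring.
  + by rewrite eq_sym.
Qed.

(** Conjugation by [G] is applied entrywise, one index after the other, in the
    form in which the effect of several successive rotations can be computed. *)
Lemma conj_entry G P (T : ('I_n -> R) -> 'I_n -> R) i j :
    P^T = P -> (forall f g i, f =1 g -> T f i = T g i) ->
    (forall (M : 'M_n) i j, (G *m M) i j = T (fun k => M k j) i) ->
  (G *m P *m G^T) i j = T (fun k => T (fun l => P k l) j) i.
Proof.
move=> sP Text GE; rewrite -mulmxA GE; apply: (Text) => k.
rewrite -[P *m _]trmxK trmx_mul trmxK sP mxE GE; apply: (Text) => l.
by rewrite -[in LHS]sP mxE.
Qed.

Lemma rot_ext x y c s f g i : f =1 g -> rot x y c s f i = rot x y c s g i.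
Proof. by move=> fg; rewrite /rot !fg. Qed.
End Rotation.

(** * Adding vertices by rotations *)

Section Extend.
Variables (R : realType) (n : nat) (e : rel 'I_n).
Hypotheses (e_sym : symmetric e) (e_irr : irreflexive e).
Implicit Types (P : 'M[R]_n) (u w g : 'cV[R]_n) (A : {set 'I_n}).

(** A diagonal entry of a projection is the sum of the squares of its row, so
    that the value [0] or [1] leaves no room for a second nonzero entry. *)
Lemma diag_interior A P s x z : realizes e A P s -> x \in A -> z \in A ->
  e x z -> (P x x != 0) && (P x x != 1).
Proof.
move=> rP xA zA exz.
have xz : x != z by apply: contraTneq exz => ->; rewrite e_irr.
have Pxz : P x z != 0 by rewrite (real_adj rP).
have [sP iP _] := real_proj rP.
have : P x x = P x x ^+ 2 + \sum_(k | k != x) P x k ^+ 2.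
  rewrite -{1}iP mxE (bigD1 x) //=; congr (_ + _); apply: eq_bigr => k _.
  by rewrite (proj_sym k x (real_proj rP)).
have S0 : 0 < \sum_(k | k != x) P x k ^+ 2.
  rewrite (bigD1 z) 1?eq_sym //=; apply: ltr_wpDr.
    by apply: sumr_ge0 => k _; apply: sqr_ge0.
  by rewrite exprn_even_gt0.
move=> Pxx; apply/andP; split; apply/eqP => E; move: Pxx S0; rewrite E; nra.
Qed.

Lemma add_isolated (eps : bool) A P s y : realizes e A P s -> y \notin A ->
  {in A, forall z, ~~ e y z} ->
  exists2 P' : 'M[R]_n, realizes e (y |: A) P' (s + eps) & P' y y = eps%:R.
Proof.
move=> rP yA yz; case: eps; last first.
  exists P; rewrite ?(real_supp rP) // addn0; split; first exact: real_proj rP.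
    by move=> i j; rewrite !inE negb_or => /andP [_]; apply: (real_supp rP).
  move=> i j; rewrite !inE => /orP [/eqP -> | iA] /orP [/eqP -> | jA]; rewrite ?eqxx //.
  - by rewrite (real_supp rP) // eqxx (negbTE (yz _ jA)).
  - rewrite (proj_sym _ _ (real_proj rP)) (real_supp rP) // eqxx e_sym.
    by rewrite (negbTE (yz _ iA)).
  - exact: (real_adj rP).
pose d : 'cV[R]_n := delta_mx y 0.
have dE i : d i 0 = (i == y)%:R by rewrite mxE eqxx andbT.
exists (P + d *m d^T); last first.
  by rewrite mxE outerE !dE eqxx mulr1 (real_supp rP) // add0r.
rewrite addn1; split.
- apply: proj_add; first exact: real_proj rP.
    exact: (mulmx_delta0 rP).
  by rewrite dot_delta dE eqxx.
- move=> i j; rewrite !inE negb_or => /andP [/negbTE iy iA].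
  by rewrite mxE outerE !dE iy mul0r addr0 (real_supp rP).
- have yA' i : i \in A -> (i == y) = false by move=> iA; apply: contraNF yA => /eqP <-.
  move=> i j; rewrite !inE mxE outerE !dE.
  move=> /orP [/eqP -> | iA] /orP [/eqP -> | jA]; rewrite ?eqxx //.
  - by rewrite (real_supp rP) // yA' // mulr0 addr0 eqxx (negbTE (yz _ jA)).
  - rewrite (proj_sym _ _ (real_proj rP)) (real_supp rP) // yA' // mul0r addr0.
    by rewrite eqxx e_sym (negbTE (yz _ iA)).
  - by rewrite yA' // mul0r addr0; apply: (real_adj rP).
Qed.

(** Give the new vertex [y] the eigenvalue [eps] and rotate in the plane of [x]
    and [y]: both rows become multiples of the old row of [x], and the entry at
    [x], [y] is a multiple of the gap between [P x x] and [eps]. *)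
Lemma add_twin (eps : bool) A P s x y : realizes e A P s -> x \in A -> y \notin A ->
    e x y -> {in A, forall z, z != x -> e y z = e x z} -> P x x != eps%:R ->
  exists P', realizes e (y |: A) P' (s + eps).
Proof.
move=> rP xA yA exy tw Pxx.
pose d : 'cV[R]_n := delta_mx y 0.
have dE i : d i 0 = (i == y)%:R by rewrite mxE eqxx andbT.
pose Q := P + eps%:R *: (d *m d^T).
have pQ : proj Q (s + eps).
  rewrite /Q; case: eps {Pxx Q}; rewrite ?scale1r ?scale0r ?addr0 ?addn1 ?addn0.
    apply: proj_add; [exact: real_proj rP | exact: (mulmx_delta0 rP) |].
    by rewrite dot_delta dE eqxx.
  exact: real_proj rP.
have QE i j : Q i j = P i j + eps%:R * ((i == y)%:R * (j == y)%:R).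
  by rewrite !mxE big_ord1 !mxE !eqxx !andbT.
have [c [q [c0 q0 cq]]] := unit_circle_point R.
have xy : x != y by apply: contraNneq yA => <-.
have yx : (y == x) = false by rewrite eq_sym (negbTE xy).
pose G := rot_mx x y c q.
have GG : G *m G^T = 1%:M by exact: rot_mx_orth.
have [sQ _ _] := pQ.
pose P' := G *m Q *m G^T.
have P'E i j : P' i j = rot x y c q (fun k => rot x y c q (fun l => Q k l) j) i.
  apply: (conj_entry (T := rot x y c q)) => //; first by move=> *; apply: rot_ext.
  by move=> *; rewrite rot_mxE.
have pP' : proj P' (s + eps) := proj_conj GG pQ.
have P0 i : P i y = 0 by rewrite (proj_sym _ _ (real_proj rP)) (real_supp rP).
have P0' i : P y i = 0 by rewrite (real_supp rP).
have yA' i : i \in A -> (i == y) = false by move=> iA; apply: contraNF yA => /eqP <-.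
have P'yz z : z \in A -> z != x -> P' y z = q * P x z.
  move=> zA zx; rewrite P'E /rot yx eqxx (negbTE zx) (yA' _ zA).
  by rewrite !QE !(yA' _ zA) P0' /=; ring.
have P'xz z : z \in A -> z != x -> P' x z = c * P x z.
  move=> zA zx; rewrite P'E /rot eqxx (negbTE zx) (yA' _ zA).
  by rewrite !QE !(yA' _ zA) P0' /=; ring.
have P'xy : P' x y = c * q * (P x x - eps%:R).
  by rewrite P'E /rot yx !eqxx !QE (negbTE xy) !eqxx !P0 !P0' /=; ring.
have P'yA z : z \in A -> (P' y z != 0) = e y z.
  move=> zA; case: (eqVneq z x) => [-> | zx].
    rewrite (proj_sym _ _ pP') P'xy !mulf_eq0 (negbTE c0) (negbTE q0) /=.
    by rewrite subr_eq0 Pxx e_sym exy.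
  rewrite P'yz // mulf_eq0 (negbTE q0) tw //.
  by apply: (real_adj rP); rewrite // eq_sym.
exists P'; split=> //.
- move=> i j; rewrite !inE negb_or => /andP [/negbTE iy iA].
  have ix : (i == x) = false by apply: contraNF iA => /eqP ->.
  rewrite P'E /rot ix iy.
  have Qi k : Q i k = 0 by rewrite QE iy mul0r mulr0 addr0 (real_supp rP).
  by rewrite !Qi !mulr0 subrr addr0 !if_same.
- move=> i j; rewrite !inE => /orP [/eqP -> | iA] /orP [/eqP -> | jA]; rewrite ?eqxx //.
  + by move=> _; apply: P'yA.
  + by move=> _; rewrite (proj_sym _ _ pP') e_sym; apply: P'yA.
  + case: (eqVneq i x) => [-> | ix].
      move=> xj; rewrite P'xz 1?[j == x]eq_sym // mulf_eq0 (negbTE c0).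
      exact: (real_adj rP).
    case: (eqVneq j x) => [-> | jx].
      move=> _; rewrite (proj_sym _ _ pP') P'xz // mulf_eq0 (negbTE c0) e_sym.
      by apply: (real_adj rP); rewrite // eq_sym.
    move=> ij; rewrite P'E /rot (negbTE ix) (negbTE jx) !yA' // QE !yA' //.
    rewrite mulr0 mulr0 addr0.
    exact: (real_adj rP).
Qed.

(** [a] and [b] being nonadjacent, this says that the principal submatrix of [P]
    at [a], [b] is a nonzero scalar matrix. *)
Definition isotropic P a b := (P a a == P b b) && (P a a != 0).

(** Make [a] a twin of [a0] and [b] a twin of [b0] by rotations with the same
    angle and eigenvalue [0].  The principal submatrix at [a], [b] is then still
    scalar, so that a rotation in the plane of [a] and [b] keeps the entry at [a],
    [b] zero, while it makes [a] and [b] adjacent to all of the old vertices. *)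
Lemma split_pair A P s a0 b0 a b : realizes e A P s ->
    a0 \in A -> b0 \in A -> a0 != b0 -> ~~ e a0 b0 ->
    {in A, forall v, v != a0 -> v != b0 -> e a0 v && e b0 v} ->
    isotropic P a0 b0 ->
    a != b -> ~~ e a b -> {in A, forall v, e a v && e b v} ->
  exists2 P', realizes e (a |: (b |: A)) P' s & isotropic P' a0 b0.
Proof.
move=> rP a0A b0A ab0 nab0 ab0A /andP [/eqP Pab0 Paa] ab nab abA.
have aA : a \notin A by apply/negP => /abA; rewrite e_irr.
have bA : b \notin A by apply/negP => /abA; rewrite e_irr andbF.
pose f (i : 'I_n + 'I_n) := match i with inl i => P a0 i | inr i => P b0 i end.
pose d (i : 'I_n + 'I_n) := match i with inl i => - P b0 i | inr i => P a0 i end.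
have [t /andP [t0 t1] tE] := avoid_affine f d.
have t2 : 0 < 1 + t * t by nra.
pose C := (Num.sqrt (1 + t * t))^-1; pose S := t * C.
have tn0 : t != 0 by rewrite gt_eqF.
have C0 : C != 0 by rewrite invr_eq0 sqrtr_eq0 -ltNge.
have S0 : S != 0 by rewrite mulf_neq0 // gt_eqF.
have CS : C * C + S * S = 1.
  have -> : C * C + S * S = (1 + t * t) * (C * C) by rewrite /S; ring.
  rewrite /C -invfM -[Num.sqrt _ * _]expr2 sqr_sqrtr ?ltW // divff // gt_eqF //.
have [g [h [g0 h0 gh]]] := unit_circle_point R.
have Aa i : i \in A -> (i == a) = false by move=> iA; apply: contraNF aA => /eqP <-.
have Ab i : i \in A -> (i == b) = false by move=> iA; apply: contraNF bA => /eqP <-.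
have aa0 : (a == a0) = false by rewrite eq_sym Aa.
have ab0' : (a == b0) = false by rewrite eq_sym Aa.
have ba0 : (b == a0) = false by rewrite eq_sym Ab.
have bb0 : (b == b0) = false by rewrite eq_sym Ab.
pose G1 := rot_mx a0 a g h; pose G2 := rot_mx b0 b g h; pose G3 := rot_mx a b C S.
pose G := G3 *m (G2 *m G1).
have G1o : G1 *m G1^T = 1%:M by apply: rot_mx_orth; rewrite ?Aa.
have G2o : G2 *m G2^T = 1%:M by apply: rot_mx_orth; rewrite ?Ab.
have G3o : G3 *m G3^T = 1%:M by apply: rot_mx_orth.
have GG : G *m G^T = 1%:M.
  rewrite /G !trmx_mul !mulmxA -[_ *m G1 *m G1^T]mulmxA G1o mulmx1.
  by rewrite -[_ *m G2 *m G2^T]mulmxA G2o mulmx1.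
pose T f := rot a b C S (rot b0 b g h (rot a0 a g h f)).
have Text F F' i : F =1 F' -> T F i = T F' i.
  by move=> FF; do 3!(apply: rot_ext => ?); rewrite FF.
have GE (M : 'M_n) i j : (G *m M) i j = T (fun k => M k j) i.
  rewrite /G -!mulmxA rot_mxE; apply: rot_ext => k.
  by rewrite rot_mxE; apply: rot_ext => l; rewrite rot_mxE.
pose P' := G *m P *m G^T.
have pP' : proj P' s := proj_conj GG (real_proj rP).
have P'E i j : P' i j = T (fun k => T (fun l => P k l) j) i.
  by apply: conj_entry GE => //; case: (real_proj rP).
have nab0' : (b0 == a0) = false by rewrite eq_sym (negbTE ab0).
have ba : (b == a) = false by rewrite eq_sym (negbTE ab).
(* the rotations applied to a vector vanishing at the two new vertices *)
have Ta0 F : F a = 0 -> F b = 0 -> T F a0 = g * F a0.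
  by move=> Fa Fb; rewrite /T /rot !(eqxx, Aa, Ab, nab0', negbTE ab0) // Fa; ring.
have Tb0 F : F a = 0 -> F b = 0 -> T F b0 = g * F b0.
  move=> Fa Fb; rewrite /T /rot.
  by rewrite !(eqxx, Aa, Ab, nab0', ba0, ba, negbTE ab0) // Fb; ring.
have Ta F : F a = 0 -> F b = 0 -> T F a = h * (C * F a0 - S * F b0).
  move=> Fa Fb; rewrite /T /rot !(eqxx, Aa _ b0A, aa0, ab0', nab0', ba0, ba, bb0).
  by rewrite !(negbTE ab, negbTE ab0, eqxx) Fa Fb; ring.
have Tb F : F a = 0 -> F b = 0 -> T F b = h * (S * F a0 + C * F b0).
  move=> Fa Fb; rewrite /T /rot !(eqxx, Aa _ b0A, aa0, ab0', nab0', ba0, ba, bb0).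
  by rewrite !(negbTE ab, negbTE ab0, eqxx) Fa Fb; ring.
have Ti F i : i != a0 -> i != b0 -> i != a -> i != b -> T F i = F i.
  by move=> /negbTE ia0 /negbTE ib0 /negbTE ia /negbTE ib; rewrite /T /rot ia ib ib0 ia0.
have Psym := proj_sym _ _ (real_proj rP).
have P0a i : P i a = 0 by rewrite Psym (real_supp rP).
have P0b i : P i b = 0 by rewrite Psym (real_supp rP).
have Pa0 i : P a i = 0 by rewrite (real_supp rP).
have Pb0 i : P b i = 0 by rewrite (real_supp rP).
have P00 : P a0 b0 = 0 by apply/eqP; rewrite -[_ == _]negbK (real_adj rP).
have P00' : P b0 a0 = 0 by rewrite Psym.
have Taa j : T (fun l => P a l) j = 0.
  by rewrite /T /rot !Pa0 !(mulr0, subrr, addr0, if_same).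
have Tbb j : T (fun l => P b l) j = 0.
  by rewrite /T /rot !Pb0 !(mulr0, subrr, addr0, if_same).
have P'a0 j : P' a0 j = g * T (fun l => P a0 l) j by rewrite P'E Ta0 ?Taa ?Tbb.
have P'b0 j : P' b0 j = g * T (fun l => P b0 l) j by rewrite P'E Tb0 ?Taa ?Tbb.
have P'a j : P' a j = h * (C * T (fun l => P a0 l) j - S * T (fun l => P b0 l) j).
  by rewrite P'E Ta ?Taa ?Tbb.
have P'b j : P' b j = h * (S * T (fun l => P a0 l) j + C * T (fun l => P b0 l) j).
  by rewrite P'E Tb ?Taa ?Tbb.
exists P'; last first.
  rewrite /isotropic P'a0 P'b0 Ta0 // Tb0 // Pab0 eqxx /=.
  by rewrite !mulf_neq0 // -Pab0.
have P's := proj_sym _ _ pP'.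
have P'ab : P' a b = 0.
  by rewrite P'a !Tb // P00 P00' -Pab0; ring.
have P'aA i : i \in A -> (P' a i != 0) = e a i.
  move=> iA; have /andP [-> _] := abA _ iA.
  rewrite P'a; case: (eqVneq i a0) => [-> | ia0].
    by rewrite !Ta0 // P00' !mulr0 subr0 !mulf_neq0.
  case: (eqVneq i b0) => [-> | ib0].
    by rewrite !Tb0 // P00 !mulr0 sub0r -Pab0 mulf_neq0 // oppr_eq0 !mulf_neq0 //.
  rewrite !Ti ?Aa ?Ab // mulf_neq0 //.
  have -> : C * P a0 i - S * P b0 i = C * (P a0 i + t * - P b0 i) by rewrite /S; ring.
  rewrite mulf_neq0 // (tE (inl i)) //= (real_adj rP) // 1?eq_sym //.
  by have /andP [-> _] := ab0A _ iA ia0 ib0.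
have P'bA i : i \in A -> (P' b i != 0) = e b i.
  move=> iA; have /andP [_ ->] := abA _ iA.
  rewrite P'b; case: (eqVneq i a0) => [-> | ia0].
    by rewrite !Ta0 // P00' !mulr0 addr0 !mulf_neq0.
  case: (eqVneq i b0) => [-> | ib0].
    by rewrite !Tb0 // P00 !mulr0 add0r -Pab0 !mulf_neq0 //.
  rewrite !Ti ?Aa ?Ab // mulf_neq0 //.
  have -> : S * P a0 i + C * P b0 i = C * (P b0 i + t * P a0 i) by rewrite /S; ring.
  rewrite mulf_neq0 // (tE (inr i)) //= (real_adj rP) // 1?eq_sym //.
  by have /andP [_ ->] := ab0A _ iA ia0 ib0.
have P'Tz i j : i \in A -> j \in A -> exists2 k, k != 0 & P' i j = k * P i j.
  move=> iA jA.
  have [k k0 kE] : exists2 k, k != 0 & forall F, F a = 0 -> F b = 0 -> T F i = k * F i.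
    case: (eqVneq i a0) => [-> | ia0]; first by exists g.
    case: (eqVneq i b0) => [-> | ib0]; first by exists g.
    by exists 1; rewrite ?oner_neq0 // => F _ _; rewrite mul1r Ti ?Aa ?Ab.
  have [l l0 lE] : exists2 k, k != 0 & forall F, F a = 0 -> F b = 0 -> T F j = k * F j.
    case: (eqVneq j a0) => [-> | ia0]; first by exists g.
    case: (eqVneq j b0) => [-> | ib0]; first by exists g.
    by exists 1; rewrite ?oner_neq0 // => F _ _; rewrite mul1r Ti ?Aa ?Ab.
  exists (k * l); first exact: mulf_neq0.
  by rewrite P'E kE ?Taa ?Tbb // lE // mulrA.
split=> //.
- move=> i j; rewrite !inE !negb_or => /and3P [ia ib iA].
  have ia0 : i != a0 by apply: contraNneq iA => ->.
  have ib0 : i != b0 by apply: contraNneq iA => ->.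
  rewrite P'E Ti //.
  by rewrite /T /rot !(real_supp rP) // !(mulr0, subrr, addr0, if_same).
- move=> i j; rewrite !inE.
  case/or3P => [/eqP -> | /eqP -> | iA]; case/or3P => [/eqP -> | /eqP -> | jA] //;
    rewrite ?eqxx //.
  + by rewrite P'ab eqxx (negbTE nab).
  + by move=> _; apply: P'aA.
  + by rewrite P's P'ab eqxx e_sym (negbTE nab).
  + by move=> _; apply: P'bA.
  + by move=> _; rewrite P's e_sym; apply: P'aA.
  + by move=> _; rewrite P's e_sym; apply: P'bA.
  + move=> ij; have [k k0 ->] := P'Tz _ _ iA jA.
    by rewrite mulf_eq0 (negbTE k0) (real_adj rP).
Qed.
End Extend.

(** * Projections of rank two *)

Section Frames.
Variables (R : realType) (n : nat) (e : rel 'I_n).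
Hypotheses (e_sym : symmetric e) (e_irr : irreflexive e).

(** The vector [sqrt wt * (px, py)] of the plane, and a sign.  Square roots only
    enter through [wt], so that the conditions on a list of such vectors can be
    checked on rational data. *)
Record datum := Datum { wt : R; px : R; py : R; sg : R }.

Definition datum0 := Datum 0 0 0 0.

Variables (vs : seq 'I_n) (ds : seq datum).
Hypotheses (vs_uniq : uniq vs) (sz_ds : size ds = size vs).

Let d_ v := nth datum0 ds (index v vs).

Lemma sum_frame (F : datum -> R) : F datum0 = 0 ->
  \sum_v F (d_ v) = \sum_(d <- ds) F d.
Proof.
move=> F0; have -> : ds = [seq d_ v | v <- vs].
  apply: (@eq_from_nth _ datum0); rewrite ?size_map // => i ilt.
  case: vs vs_uniq sz_ds @d_ => [|v0 vs'] uvs szs d'.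
    by move: ilt; rewrite szs.
  by rewrite (nth_map v0) -?szs // /d' index_uniq // -szs.
rewrite big_map [in RHS]big_uniq //= [LHS](bigID (mem vs)) /= addrC.
rewrite big1 ?add0r // => v vvs.
by rewrite /d_ nth_default ?F0 // sz_ds leqNgt index_mem.
Qed.

Hypothesis wt_pos : all (fun d => 0 < wt d) ds.
Hypotheses (sum_xx : \sum_(d <- ds) wt d * px d ^+ 2 = 1)
           (sum_yy : \sum_(d <- ds) wt d * py d ^+ 2 = 1)
           (sum_xy : \sum_(d <- ds) wt d * (px d * py d) = 0).
Hypothesis ds_adj : forall v0 i j, (i < j < size vs)%N ->
  let di := nth datum0 ds i in let dj := nth datum0 ds j in
  (px di * px dj + py di * py dj != 0) = e (nth v0 vs i) (nth v0 vs j).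

(** Three conditions on the weights make the vectors of the plane a Parseval
    frame, so that their Gram matrix [frame_proj] is a projection, with image
    spanned by the columns [frame_x], [frame_y] of coordinates. *)
Definition frame_x : 'cV[R]_n := \col_v (Num.sqrt (wt (d_ v)) * px (d_ v)).
Definition frame_y : 'cV[R]_n := \col_v (Num.sqrt (wt (d_ v)) * py (d_ v)).
Definition frame_u : 'cV[R]_n := \col_v (sg (d_ v) * frame_x v 0).
Definition frame_proj := frame_x *m frame_x^T + frame_y *m frame_y^T.

Let wt_gt0 v : v \in vs -> 0 < wt (d_ v).
Proof. by move=> vvs; apply: (all_nthP datum0 wt_pos); rewrite sz_ds index_mem. Qed.

Let wt_ge0 v : 0 <= wt (d_ v).
Proof.
case: (boolP (v \in vs)) => [/wt_gt0/ltW //|vvs].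
by rewrite /d_ nth_default // sz_ds leqNgt index_mem.
Qed.

Let sqrt_wt v : Num.sqrt (wt (d_ v)) * Num.sqrt (wt (d_ v)) = wt (d_ v).
Proof. by rewrite -expr2 sqr_sqrtr. Qed.

Let dot_frame (F G : datum -> R) :
  dot (\col_v (Num.sqrt (wt (d_ v)) * F (d_ v)))
      (\col_v (Num.sqrt (wt (d_ v)) * G (d_ v)))
  = \sum_(d <- ds) wt d * (F d * G d).
Proof.
rewrite -(sum_frame (F := fun d => wt d * (F d * G d))) ?mul0r // dotE.
by apply: eq_bigr => v _; rewrite !mxE -[in RHS]sqrt_wt; ring.
Qed.

Lemma frame_realizes : realizes e [set v in vs] frame_proj 2.
Proof.
have xx : dot frame_x frame_x = 1.
  by rewrite dot_frame -[RHS]sum_xx; apply: eq_bigr => d _; rewrite expr2.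
have yy : dot frame_y frame_y = 1.
  by rewrite dot_frame -[RHS]sum_yy; apply: eq_bigr => d _; rewrite expr2.
have xy : dot frame_x frame_y = 0 by rewrite dot_frame sum_xy.
split.
- apply: proj_add => //; last by rewrite outer_mul xy scale0r.
  rewrite -[_ *m _]add0r; apply: proj_add => //; first exact: proj0.
  by rewrite mul0mx.
- move=> i j; rewrite inE => ivs; rewrite !mxE !big_ord1 !mxE.
  have -> : d_ i = datum0 by rewrite /d_ nth_default // sz_ds leqNgt index_mem.
  by rewrite /= !(mulr0, mul0r) addr0.
have fE i j : frame_proj i j = Num.sqrt (wt (d_ i)) * Num.sqrt (wt (d_ j)) *
    (px (d_ i) * px (d_ j) + py (d_ i) * py (d_ j)).
  by rewrite !mxE !big_ord1 !mxE; ring.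
have sq v : v \in vs -> Num.sqrt (wt (d_ v)) != 0.
  by move=> vvs; rewrite sqrtr_eq0 -ltNge wt_gt0.
have main i j : i \in vs -> j \in vs -> (index i vs < index j vs)%N ->
    (frame_proj i j != 0) = e i j.
  move=> ivs jvs ij; rewrite fE mulf_eq0 negb_or mulf_neq0 ?sq //=.
  have := @ds_adj i (index i vs) (index j vs).
  by rewrite /= ij index_mem jvs !nth_index // => ->.
move=> i j; rewrite !inE => ivs jvs ij.
case: (ltngtP (index i vs) (index j vs)) => [|ji|/(index_inj i) E].
- exact: main.
- by rewrite e_sym -main // !fE; congr (_ * _ != 0); ring.
- by move: ij; rewrite E // eqxx.
Qed.

Lemma frame_diag v0 i : (i < size vs)%N -> let d := nth datum0 ds i in
  frame_proj (nth v0 vs i) (nth v0 vs i) = wt d * (px d ^+ 2 + py d ^+ 2).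
Proof.
move=> ilt d; have dE : d_ (nth v0 vs i) = d by rewrite /d_ index_uniq.
by rewrite !mxE !big_ord1 !mxE -[in RHS]dE -[in RHS]sqrt_wt; ring.
Qed.

Hypothesis ds_px : all (fun d => px d != 0) ds.
Hypothesis ds_sg : all (fun d => sg d ^+ 2 == 1) ds.
Hypotheses (sum_sxx : \sum_(d <- ds) wt d * (sg d * px d ^+ 2) = 0)
           (sum_sxy : \sum_(d <- ds) wt d * (sg d * (px d * py d)) = 0).
Hypothesis ds_nadj : forall v0 i j, (i < j < size vs)%N ->
  ~~ e (nth v0 vs i) (nth v0 vs j) ->
  sg (nth datum0 ds i) = sg (nth datum0 ds j).

(** Flipping signs in [frame_x] gives a vector [u] with [u_i^2 = w_i^2] for
    [w = frame_x].  It lies in the kernel if the signed sums vanish, and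
    [u_i u_j = w_i w_j] as soon as nonadjacent vertices carry the same sign. *)
Lemma frame_balanced :
  balanced e [set v in vs] frame_proj frame_u frame_x /\
  forall i, frame_u i 0 ^+ 2 = frame_x i 0 ^+ 2.
Proof.
have uE : frame_u = \col_v (Num.sqrt (wt (d_ v)) * (sg (d_ v) * px (d_ v))).
  by apply/matrixP => i j; rewrite !mxE mulrCA.
have xx : dot frame_x frame_x = 1.
  by rewrite dot_frame -[RHS]sum_xx; apply: eq_bigr => d _; rewrite expr2.
have xy : dot frame_x frame_y = 0 by rewrite dot_frame sum_xy.
have ux : dot frame_x frame_u = 0.
  rewrite uE (dot_frame px (fun d => sg d * px d)) -[RHS]sum_sxx.
  by apply: eq_bigr => d _; ring.
have uy : dot frame_y frame_u = 0.
  rewrite uE (dot_frame py (fun d => sg d * px d)) -[RHS]sum_sxy.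
  by apply: eq_bigr => d _; ring.
have xout v : v \notin vs -> frame_x v 0 = 0.
  move=> vvs; rewrite mxE /d_ nth_default /= ?mulr0 //.
  by rewrite sz_ds leqNgt index_mem.
have sg2 v : v \in vs -> sg (d_ v) ^+ 2 = 1.
  by move=> vvs; apply/eqP; apply: (all_nthP datum0 ds_sg); rewrite sz_ds index_mem.
have x0 v : (frame_x v 0 != 0) = (v \in [set w in vs]).
  rewrite inE; case: (boolP (v \in vs)) => [vvs|/xout ->]; last by rewrite eqxx.
  rewrite mxE mulf_neq0 //; last first.
    by apply: (all_nthP datum0 ds_px); rewrite sz_ds index_mem.
  by rewrite sqrtr_eq0 -ltNge wt_gt0.
have u2 v : frame_u v 0 ^+ 2 = frame_x v 0 ^+ 2.
  rewrite mxE exprMn; case: (boolP (v \in vs)) => [/sg2 ->|/xout ->].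
    by rewrite mul1r.
  by rewrite expr0n mulr0.
split=> //; split.
- by rewrite mulmxDl !outer_mul ux uy !scale0r addr0.
- by rewrite mulmxDl !outer_mul xx [dot frame_y _]dotC xy scale0r scale1r addr0.
- by rewrite -[RHS]xx !dotE; apply: eq_bigr => v _; rewrite -!expr2 u2.
- by [].
- by move=> v; rewrite -x0 -(sqrf_eq0 (frame_u v 0)) u2 sqrf_eq0.
- by [].
- move=> i j; rewrite !inE => ivs jvs ij eij.
  have sgE : sg (d_ i) = sg (d_ j).
    case: (ltngtP (index i vs) (index j vs)) => [lt|lt|/(index_inj i) E].
    + by apply: (ds_nadj (v0 := i)); rewrite ?lt ?index_mem // !nth_index.
    + by apply/esym/(ds_nadj (v0 := i)); rewrite ?lt ?index_mem // !nth_index // e_sym.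
    + by move: ij; rewrite E // eqxx.
  by rewrite ![frame_u _ _]mxE mulrACA sgE -expr2 sg2 // mul1r.
Qed.

Lemma frame_base : exists (P : 'M[R]_n) u w,
  [/\ realizes e [set v in vs] P 2, balanced e [set v in vs] P u w,
      forall i, u i 0 ^+ 2 = w i 0 ^+ 2 &
      forall v0 i, (i < size vs)%N -> let d := nth datum0 ds i in
        P (nth v0 vs i) (nth v0 vs i) = wt d * (px d ^+ 2 + py d ^+ 2)].
Proof.
exists frame_proj, frame_u, frame_x; have [bal uw2] := frame_balanced.
by split=> //; [apply: frame_realizes | apply: frame_diag].
Qed.
End Frames.

(** * Filling up with twins and isolated vertices *)

Section Saturate.
Variables (R : realType) (n : nat) (e : rel 'I_n).
Hypotheses (e_sym : symmetric e) (e_irr : irreflexive e).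
Implicit Types (P : 'M[R]_n) (A : {set 'I_n}).

Definition absorbs A y := [forall z, ~~ e y z] ||
  [exists x in A, [&& [exists z in A, e x z], e x y &
     [forall z, (z != x) && (z != y) ==> (e y z == e x z)]]].

Lemma saturate A P s j : realizes e A P s -> {in ~: A, forall y, absorbs A y} ->
  (j <= #|~: A|)%N -> exists P', realizes e [set: 'I_n] P' (s + j).
Proof.
move mE : #|~: A| => m; elim: m A P s j mE => [|m IH] A P s j mE rP absA.
  rewrite leqn0 => /eqP ->; exists P; rewrite addn0.
  by have /eqP := mE; rewrite cards_eq0 -setCT => /eqP /setC_inj <-.
have /card_gt0P [y] : (0 < #|~: A|)%N by rewrite mE.
rewrite inE => yA jm.
have [P' rP'] : exists P', realizes e (y |: A) P' (s + (0 < j)%N).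
  have /orP [/forallP iso|/existsP [x /and4P [xA ex exy /forallP tw]]] :
      absorbs A y by apply: absA; rewrite inE.
    have [z _|P' rP' _] := add_isolated e_sym (0 < j)%N rP yA; first exact: iso.
    by exists P'.
  have /existsP [z /andP [zA exz]] := ex.
  apply: (add_twin e_sym rP xA yA exy).
    move=> w wA wx; apply/eqP; apply: (implyP (tw w)); rewrite wx.
    by apply: contraNneq yA => <-.
  have /andP [Px0 Px1] := diag_interior e_irr rP xA zA exz.
  by case: (0 < j)%N.
have -> : (s + j)%N = (s + (0 < j)%N + j.-1)%N by rewrite -addnA; case: (j).
apply: (IH (y |: A) P') => //.
- have := cardsD1 y (~: A); rewrite mE inE yA setCU setIC -setDE => [[->]] //.
- move=> v; rewrite !inE negb_or => /andP [vy vA].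
  have /orP [iso|/existsP [x /and3P [xA /existsP [z /andP [zA exz]] tw]]] :
      absorbs A v by apply: absA; rewrite inE.
    by apply/orP; left.
  apply/orP; right; apply/existsP; exists x; rewrite inE xA orbT tw andbT /=.
  by apply/existsP; exists z; rewrite inE zA orbT.
- by rewrite -subn1 leq_subLR add1n.
Qed.
End Saturate.

(** * Graphs built from nonadjacent pairs *)

Section Pairs.
Variables (R : realType) (n : nat) (e : rel 'I_n).
Hypotheses (e_sym : symmetric e) (e_irr : irreflexive e).
Implicit Types (P : 'M[R]_n) (A : {set 'I_n}).
Variables (Z : {set 'I_n}) (a b : nat -> 'I_n) (K : nat).

(** The [a i], [b i] with [i < K] induce the complement of a perfect matching,
    all of it joined to [Z]. *)
Record pair_system : Prop := PairSystem {
  pair_neq : forall i, (i < K)%N -> a i != b i;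
  pair_nadj : forall i, (i < K)%N -> ~~ e (a i) (b i);
  pair_aa : forall i j, (i < K)%N -> (j < K)%N -> i != j -> e (a i) (a j);
  pair_ab : forall i j, (i < K)%N -> (j < K)%N -> i != j -> e (a i) (b j);
  pair_bb : forall i j, (i < K)%N -> (j < K)%N -> i != j -> e (b i) (b j);
  pair_Z : {in Z, forall z i, (i < K)%N -> e z (a i) && e z (b i)} }.

Hypothesis ps : pair_system.

Lemma pair_dominates i v : (i < K)%N ->
    (v \in Z \/ exists j, [/\ (j < K)%N, i != j & v = a j \/ v = b j]) ->
  e (a i) v && e (b i) v.
Proof.
move=> iK [vZ|[j [jK ij]]].
  by have /andP [za zb] := pair_Z ps vZ iK; rewrite e_sym za e_sym zb.
case=> ->; first by rewrite (pair_aa ps) // e_sym (pair_ab ps) // eq_sym.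
by rewrite (pair_ab ps) // (pair_bb ps).
Qed.

Definition pairset k :=
  Z :|: [set v | has (fun i => (v == a i) || (v == b i)) (iota 0 k)].

Lemma in_pairset k v :
  reflect (v \in Z \/ exists2 i, (i < k)%N & v = a i \/ v = b i)
          (v \in pairset k).
Proof.
rewrite !inE; apply: (iffP orP) => [[|/hasP [i]]|[|[i ik vE]]]; try by left.
  by rewrite mem_iota => ik /orP [] /eqP ->; right; exists i; auto.
right; apply/hasP; exists i; rewrite ?mem_iota //.
by case: vE => ->; rewrite eqxx ?orbT.
Qed.

Lemma mem_pairset i k : (i < k)%N -> (a i \in pairset k) * (b i \in pairset k).
Proof. by move=> ik; split; apply/in_pairset; right; exists i; auto. Qed.

Lemma pairsetS k : pairset k.+1 = a k |: (b k |: pairset k).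
Proof.
apply/setP => v; rewrite !inE -addn1 iotaD has_cat /= orbF add0n.
by rewrite orbA orbC -orbA.
Qed.

Lemma card_pairset k : (#|pairset k| <= #|Z| + 2 * k)%N.
Proof.
elim: k => [|k IH].
  rewrite addn0; apply/subset_leq_card/subsetP => v.
  by case/in_pairset => [|[i]].
rewrite pairsetS mulnS addnCA cardsU1.
apply: (@leq_add _ _ 1 _.+1); first exact: leq_b1.
by rewrite cardsU1; apply: (@leq_add _ _ 1); first exact: leq_b1.
Qed.

Lemma next_pair_dominates k : (k < K)%N ->
  {in pairset k, forall v, e (a k) v && e (b k) v}.
Proof.
move=> kK v /in_pairset vk; apply: pair_dominates => //.
case: vk => [|[i ik vE]]; [by left | right; exists i].
by split=> //; [apply: ltn_trans kK | rewrite gtn_eqF].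
Qed.

Lemma join_pairs d k P s u w : (k + d <= K)%N ->
    realizes e (pairset k) P s -> balanced e (pairset k) P u w ->
  exists P' u' w', [/\ realizes e (pairset (k + d)) P' (s + d),
    balanced e (pairset (k + d)) P' u' w' &
    {in pairset k, forall i, u i 0 ^+ 2 = w i 0 ^+ 2 ->
       P' i i = P i i /\ u' i 0 ^+ 2 = w' i 0 ^+ 2}].
Proof.
move=> kd rP bP; elim: d kd => [|d IH] kd.
  by exists P, u, w; rewrite !addn0; split.
have [|P1 [u1 [w1 [rP1 bP1 dg1]]]] := IH; first by rewrite ltnW // -addnS.
rewrite addnS in kd.
have [P2 [u2 [w2 [rP2 bP2 dg2]]]] := join_pair e_sym e_irr rP1 bP1
  (pair_neq ps kd) (pair_nadj ps kd) (next_pair_dominates kd).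
exists P2, u2, w2; rewrite !addnS pairsetS; split=> // i ik uw.
have [Pi uw1] := dg1 i ik uw; rewrite -Pi; apply: dg2 => //.
case/in_pairset: ik => [iZ|[j jk vE]]; apply/in_pairset; [by left|right].
by exists j => //; apply: leq_trans jk _; rewrite leq_addr.
Qed.

Lemma split_pairs d k P s i : (k + d <= K)%N -> (i < k)%N ->
    realizes e (pairset k) P s -> isotropic P (a i) (b i) ->
  exists P' : 'M[R]_n, realizes e (pairset (k + d)) P' s.
Proof.
move=> kd ik rP iP.
suff [P' rP' _] : exists2 P' : 'M[R]_n, realizes e (pairset (k + d)) P' s &
    isotropic P' (a i) (b i) by exists P'.
elim: d kd => [|d IH] kd; first by exists P; rewrite ?addn0.
have [|P1 rP1 iP1] := IH; first by rewrite ltnW // -addnS.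
rewrite addnS in kd.
have ikd : (i < k + d)%N by rewrite (leq_trans ik) // leq_addr.
have iK := ltn_trans ikd kd.
rewrite addnS pairsetS; apply: (split_pair e_sym e_irr rP1 _ _ (pair_neq ps iK)
  (pair_nadj ps iK) _ iP1 (pair_neq ps kd) (pair_nadj ps kd)).
- by rewrite mem_pairset.
- by rewrite mem_pairset.
- move=> v /in_pairset vk va vb; apply: pair_dominates => //.
  case: vk => [|[j jk vE]]; [by left | right; exists j].
  split; [exact: ltn_trans kd | | by []].
  by apply/eqP => ij; case: vE => vE; [move: va | move: vb]; rewrite vE ij eqxx.
- exact: next_pair_dominates.
Qed.
End Pairs.

(** * Two or three pairs *)

Section Bases.
Variables (R : realType) (n : nat) (e : rel 'I_n).
Hypotheses (e_sym : symmetric e) (e_irr : irreflexive e).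
Variables (Z : {set 'I_n}) (a b : nat -> 'I_n) (K : nat).
Hypothesis ps : pair_system e Z a b K.

Let adj_ba i j : (i < K)%N -> (j < K)%N -> i != j -> e (b i) (a j).
Proof. by move=> iK jK ij; rewrite e_sym (pair_ab ps) // eq_sym. Qed.

Let adj_za z i : z \in Z -> (i < K)%N -> e z (a i).
Proof. by move=> zZ iK; have /andP [] := pair_Z ps zZ iK. Qed.

Let adj_zb z i : z \in Z -> (i < K)%N -> e z (b i).
Proof. by move=> zZ iK; have /andP [] := pair_Z ps zZ iK. Qed.

Let adjE := (pair_aa ps, pair_ab ps, adj_ba, pair_bb ps, adj_za, adj_zb).

Let e_neq x y : e x y -> x != y.
Proof. by apply: contraTneq => ->; rewrite e_irr. Qed.

Local Notation vec := (@Datum R).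

(* the verifications of the hypotheses of frame_base on explicit lists *)
Ltac distinct_vertices :=
  rewrite /= !inE !negb_or; do ?(apply/andP; split) => //;
  first [by apply: (pair_neq ps) | by apply: e_neq; rewrite ?adjE].
Ltac positive := rewrite /=; do ?(apply/andP; split) => //; lra.
Ltac plane_sum := rewrite !big_cons big_nil /=; field.
Ltac scalar_product :=
  rewrite ?andbF // => _;
  first [ rewrite (negbTE (pair_nadj ps _)) //; apply/negbTE; rewrite negbK;
          apply/eqP; lra
        | rewrite ?adjE //; apply/eqP; lra ].
Ltac nonzero_px := rewrite /= ?(oppr_eq0, pnatr_eq0, oner_eq0).
Ltac square_sg := rewrite /= ?sqrrN ?expr1n ?eqxx.
Ltac same_sign := rewrite ?andbF // => _; rewrite ?adjE.

(** Two orthogonal bases of the plane of equal weight, with opposite signs. *)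
Lemma base_two_pairs : (1 < K)%N -> exists (P : 'M[R]_n) u w,
  [/\ realizes e (pairset set0 a b 2) P 2,
      balanced e (pairset set0 a b 2) P u w,
      forall i, u i 0 ^+ 2 = w i 0 ^+ 2 & isotropic P (a 0) (b 0)].
Proof.
move=> K2; have K1 := ltnW K2.
pose vs := [:: a 0%N; b 0%N; a 1%N; b 1%N].
pose ds := [:: vec 10%:R^-1 1 2%:R 1; vec 10%:R^-1 (-2%:R) 1 1;
               vec 10%:R^-1 2%:R 1 (-1); vec 10%:R^-1 (-1) 2%:R (-1)].
have -> : pairset set0 a b 2 = [set v in vs].
  by apply/setP => v; rewrite !inE /= orbF !orbA.
have [||||||||||||P [u [w [rP bP uw dg]]]] := @frame_base R n e e_sym vs ds.
- by distinct_vertices.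
- by [].
- by positive.
- by plane_sum.
- by plane_sum.
- by plane_sum.
- by move=> v0 [|[|[|[|i]]]] [|[|[|[|j]]]] //=; scalar_product.
- by nonzero_px.
- by square_sg.
- by plane_sum.
- by plane_sum.
- by move=> v0 [|[|[|[|i]]]] [|[|[|[|j]]]] //=; same_sign.
exists P, u, w; split=> //.
rewrite /isotropic (dg (a 0%N) 0%N) // (dg (a 0%N) 1%N) //=.
by apply/andP; split; apply/eqP; lra.
Qed.

Variable z : 'I_n.
Hypothesis zZ : z \in Z.

(** The sign is positive at the apex [z] only.  The vector of [z] takes half of
    the first coordinate, which the two pairs compensate by their inclinations
    and unequal weights; so neither pair is isotropic. *)
Lemma base_cone_two_pairs : (1 < K)%N -> exists (P : 'M[R]_n) u w,
  realizes e (pairset [set z] a b 2) P 2 /\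
  balanced e (pairset [set z] a b 2) P u w.
Proof.
move=> K2; have K1 := ltnW K2.
pose vs := [:: z; a 0%N; b 0%N; a 1%N; b 1%N].
pose ds := [:: vec 2%:R^-1 1 0 1;
  vec 30%:R^-1 2%:R 1 (-1); vec (7%:R / 60%:R) (-1) 2%:R (-1);
  vec 30%:R^-1 2%:R (-1) (-1); vec (7%:R / 60%:R) 1 2%:R (-1)].
have -> : pairset [set z] a b 2 = [set v in vs].
  by apply/setP => v; rewrite !inE /= orbF !orbA.
have [||||||||||||P [u [w [rP bP _ _]]]] := @frame_base R n e e_sym vs ds.
- by distinct_vertices.
- by [].
- by positive.
- by plane_sum.
- by plane_sum.
- by plane_sum.
- by move=> v0 [|[|[|[|[|i]]]]] [|[|[|[|[|j]]]]] //=; scalar_product.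
- by nonzero_px.
- by square_sg.
- by plane_sum.
- by plane_sum.
- by move=> v0 [|[|[|[|[|i]]]]] [|[|[|[|[|j]]]]] //=; same_sign.
by exists P, u, w.
Qed.

(** As before, with a part of the weight given to a third, isotropic pair. *)
Lemma base_cone_three_pairs : (2 < K)%N -> exists (P : 'M[R]_n) u w,
  [/\ realizes e (pairset [set z] a b 3) P 2,
      balanced e (pairset [set z] a b 3) P u w,
      forall i, u i 0 ^+ 2 = w i 0 ^+ 2 & isotropic P (a 2) (b 2)].
Proof.
move=> K3; have K2 := ltnW K3; have K1 := ltnW K2.
pose vs := [:: z; a 0%N; b 0%N; a 1%N; b 1%N; a 2%N; b 2%N].
pose ds := [:: vec 2%:R^-1 1 0 1;
  vec 120%:R^-1 2%:R 1 (-1); vec (11%:R / 120%:R) (-1) 2%:R (-1);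
  vec 120%:R^-1 2%:R (-1) (-1); vec (11%:R / 120%:R) 1 2%:R (-1);
  vec 8%:R^-1 1 1 (-1); vec 8%:R^-1 (-1) 1 (-1)].
have -> : pairset [set z] a b 3 = [set v in vs].
  by apply/setP => v; rewrite !inE /= orbF !orbA.
have [||||||||||||P [u [w [rP bP uw dg]]]] := @frame_base R n e e_sym vs ds.
- by distinct_vertices.
- by [].
- by positive.
- by plane_sum.
- by plane_sum.
- by plane_sum.
- by move=> v0 [|[|[|[|[|[|[|i]]]]]]] [|[|[|[|[|[|[|j]]]]]]] //=;
    scalar_product.
- by nonzero_px.
- by square_sg.
- by plane_sum.
- by plane_sum.
- by move=> v0 [|[|[|[|[|[|[|i]]]]]]] [|[|[|[|[|[|[|j]]]]]]] //=; same_sign.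
exists P, u, w; split=> //.
rewrite /isotropic (dg (a 0%N) 5%N) // (dg (a 0%N) 6%N) //=.
by apply/andP; split; apply/eqP; lra.
Qed.
End Bases.

(** A single pair needs two apexes: their vectors are exchanged by the reflection
    in the line of [a], which makes the frame condition diagonal. *)
Lemma base_double_cone (R : realType) (n : nat) (e : rel 'I_n)
    (z1 z2 a b : 'I_n) : symmetric e -> irreflexive e ->
    e z1 z2 -> e z1 a -> e z1 b -> e z2 a -> e z2 b -> a != b -> ~~ e a b ->
  exists P : 'M[R]_n, realizes e [set v in [:: z1; z2; a; b]] P 2.
Proof.
move=> e_sym e_irr z12 z1a z1b z2a z2b ab nab; set vs := [:: z1; z2; a; b].
pose ds := [:: Datum 10%:R^-1 2%:R 1 1; Datum 10%:R^-1 2%:R (-1) 1;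
               Datum 5%:R^-1 1 0 1; Datum (4%:R / 5%:R : R) 0 1 1].
have e_neq x y : e x y -> x != y by apply: contraTneq => ->; rewrite e_irr.
exists (frame_proj vs ds); apply: frame_realizes => //.
- rewrite /= !inE !negb_or.
  by do ?(apply/andP; split) => //; apply: e_neq.
- by rewrite /=; do ?(apply/andP; split) => //; lra.
- by rewrite !big_cons big_nil /=; field.
- by rewrite !big_cons big_nil /=; field.
- by rewrite !big_cons big_nil /=; field.
move=> v0 [|[|[|[|i]]]] [|[|[|[|j]]]] //=; rewrite ?andbF // => _;
  rewrite ?(z12, z1a, z1b, z2a, z2b, negbTE nab); by apply/eqP; lra.
Qed.

(** * All ranks up to the number of pairs *)

Section PairRanks.
Variables (R : realType) (n : nat) (e : rel 'I_n).
Hypotheses (e_sym : symmetric e) (e_irr : irreflexive e).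
Variables (a b : nat -> 'I_n) (K : nat).
Hypothesis K2 : (1 < K)%N.

(** From two pairs at rank [2], adding [s - 2] pairs by [join_pair] gives [s]
    pairs at rank [s]; the others are added at constant rank by [split_pair]. *)
Lemma cocktail_party_realizes s : pair_system e set0 a b K -> (1 < s <= K)%N ->
  exists P : 'M[R]_n, realizes e (pairset set0 a b K) P s.
Proof.
move=> ps /andP [s2 sK].
have [P [u [w [rP bP uw iP]]]] := base_two_pairs R e_sym e_irr ps K2.
have [|P1 [u1 [w1 [rP1 _ dg1]]]] := join_pairs e_sym e_irr ps (d := s - 2) _ rP bP.
  by rewrite subnKC.
rewrite !subnKC // in rP1.
have iP1 : isotropic P1 (a 0) (b 0).
  have [Pa _] : P1 (a 0) (a 0) = P (a 0) (a 0) /\ _ :=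
    dg1 _ (mem_pairset set0 a b (isT : 0 < 2)%N).1 (uw _).
  have [Pb _] : P1 (b 0) (b 0) = P (b 0) (b 0) /\ _ :=
    dg1 _ (mem_pairset set0 a b (isT : 0 < 2)%N).2 (uw _).
  by rewrite /isotropic Pa Pb.
have [||P2 rP2] := split_pairs e_sym e_irr ps (d := K - s) (i := 0) _ _ rP1 iP1.
- by rewrite subnKC.
- exact: ltnW.
by exists P2; move: rP2; rewrite subnKC.
Qed.

(** With an apex the same route works, except that [base_cone_two_pairs] has no
    isotropic pair: when some pair has to be added by [split_pair], that is for
    [s < K], the route starts from three pairs. *)
Lemma cone_realizes z s : pair_system e [set z] a b K -> (1 < s <= K)%N ->
  exists P : 'M[R]_n, realizes e (pairset [set z] a b K) P s.
Proof.
move=> ps /andP [s2]; have zz := set11 z; rewrite leq_eqVlt => /orP [/eqP ->|sK].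
  have [P [u [w [rP bP]]]] := base_cone_two_pairs R e_sym e_irr ps zz K2.
  have [|P1 [u1 [w1 [rP1 _ _]]]] :=
    join_pairs e_sym e_irr ps (d := K - 2) _ rP bP; first by rewrite subnKC.
  by exists P1; move: rP1; rewrite !subnKC.
have K3 : (2 < K)%N by apply: leq_ltn_trans sK.
have [P [u [w [rP bP uw iP]]]] := base_cone_three_pairs R e_sym e_irr ps zz K3.
have s3 : (3 + (s - 2) = s.+1)%N by rewrite addSn subnKC.
have [|P1 [u1 [w1 [rP1 _ dg1]]]] := join_pairs e_sym e_irr ps (d := s - 2) _ rP bP.
  by rewrite s3.
rewrite s3 subnKC // in rP1.
have iP1 : isotropic P1 (a 2) (b 2).
  have [Pa _] : P1 (a 2) (a 2) = P (a 2) (a 2) /\ _ :=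
    dg1 _ (mem_pairset [set z] a b (isT : 2 < 3)%N).1 (uw _).
  have [Pb _] : P1 (b 2) (b 2) = P (b 2) (b 2) /\ _ :=
    dg1 _ (mem_pairset [set z] a b (isT : 2 < 3)%N).2 (uw _).
  by rewrite /isotropic Pa Pb.
have [||P2 rP2] := split_pairs e_sym e_irr ps (d := K - s.+1) (i := 2) _ _ rP1 iP1.
- by rewrite subnKC.
- exact: s2.
by exists P2; move: rP2; rewrite subnKC.
Qed.
End PairRanks.

(** * Disjoint unions of at most two nontrivial cliques *)

Section Clusters.
Variables (R : realType) (n : nat) (e : rel 'I_n).
Hypotheses (e_sym : symmetric e) (e_irr : irreflexive e).
Implicit Types (P : 'M[R]_n) (A : {set 'I_n}).

(** Exchanging the two eigenvalues keeps the off-diagonal pattern. *)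
Lemma realizes_compl P s : (s <= n)%N -> realizes e [set: 'I_n] P s ->
  realizes e [set: 'I_n] (1%:M - P) (n - s).
Proof.
move=> sn rP; split; first exact: proj_compl (real_proj rP).
  by move=> i j; rewrite inE.
move=> i j _ _ ij; rewrite !mxE (negbTE ij) sub0r oppr_eq0.
by apply: (real_adj rP); rewrite ?inE.
Qed.

Lemma add_edge A P s x y : realizes e A P s -> x \notin A -> y \notin A ->
    e x y -> {in A, forall z, ~~ e x z && ~~ e y z} ->
  exists P', realizes e (y |: (x |: A)) P' s.+1.
Proof.
move=> rP xA yA exy xyA.
have [z zA|P1 rP1 P1x] := add_isolated e_sym true rP xA.
  by have /andP [] := xyA z zA.
have := add_twin (eps := false) e_sym rP1 _ _ exy _ _.
rewrite addn0 addn1; apply.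
- by rewrite !inE eqxx.
- by rewrite !inE negb_or yA andbT; apply: contraTneq exy => ->; rewrite e_irr.
- move=> z; rewrite !inE => /orP [/eqP ->|zA]; first by rewrite eqxx.
  by have /andP [/negbTE -> /negbTE ->] := xyA z zA.
- by rewrite P1x oner_eq0.
Qed.

Lemma saturate_from A P s0 s : realizes e A P s0 ->
    {in ~: A, forall y, absorbs e A y} ->
  (s0 <= s)%N -> (#|A| + s <= n + s0)%N -> exists P', realizes e [set: 'I_n] P' s.
Proof.
move=> rP abs s0s cA; rewrite -(subnKC s0s).
apply: (saturate e_sym e_irr rP abs).
by have := cardsC A; rewrite card_ord; lia.
Qed.

Lemma absorbs_isolated A y : (forall v, ~~ e y v) -> absorbs e A y.
Proof. by move=> iso; apply/orP; left; apply/forallP. Qed.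

Lemma absorbs_twin A x y z : x \in A -> z \in A -> e x z -> e x y ->
  (forall v, v != x -> v != y -> e y v = e x v) -> absorbs e A y.
Proof.
move=> xA zA exz exy tw; apply/orP; right; apply/existsP; exists x.
rewrite xA exy /=; apply/andP; split; first by apply/existsP; exists z; rewrite zA.
by apply/forallP => v; apply/implyP => /andP [vx vy]; rewrite tw.
Qed.

Lemma realizes0 : realizes e set0 (0 : 'M[R]_n) 0.
Proof.
by split; [exact: proj0 | move=> i j; rewrite mxE | move=> i j; rewrite inE].
Qed.

(** Take an edge in every nontrivial clique, at rank [1] each; what remains are
    twins and isolated vertices. *)
Lemma cluster_realizes (d : 'I_n -> option bool) s :
    (forall x y, e x y = [&& x != y, d x == d y & d x != None]) ->
  (1 < s)%N -> (s + 2 <= n)%N -> exists P, realizes e [set: 'I_n] P s.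
Proof.
move=> eE s2 sn.
have absE A x y z : x \in A -> y \notin A -> z \in A -> e x z -> d y = d x ->
    absorbs e A y.
  move=> xA yA zA exz dyx; apply: (absorbs_twin xA zA exz).
    rewrite eE dyx eqxx; move: exz; rewrite eE => /and3P [_ _ ->]; rewrite !andbT.
    by apply: contraNneq yA => <-.
  by move=> v vx vy; rewrite !eE dyx ![_ == v]eq_sym vx vy.
have iso_or y : (forall v, ~~ e y v) \/ exists v, e y v.
  have [/existsP|] := boolP [exists v, e y v]; first by right.
  by rewrite negb_exists => /forallP; left.
have [/existsP [x /existsP [y exy]]|noe] :=
  boolP [exists x, exists y, e x y]; last first.
  apply: (saturate_from realizes0); rewrite ?cards0 //; last lia.
  move=> y _; apply: absorbs_isolated => v; apply: contra noe => eyv.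
  by apply/existsP; exists y; apply/existsP; exists v.
have [//|||P rP] := add_edge realizes0 _ _ exy; rewrite ?inE //.
  by move=> v; rewrite inE.
rewrite setU0 in rP; set A := _ |: _ in rP.
have xA : x \in A by rewrite !inE eqxx orbT.
have yA : y \in A by rewrite !inE eqxx.
have cA : (#|A| <= 2)%N by rewrite cards2; case: (y != x).
have [/existsP [x' /existsP [y' /andP [exy' dx']]]|noe] :=
    boolP [exists x', exists y', e x' y' && (d x' != d x)]; last first.
  apply: (saturate_from rP); [|lia|lia].
  move=> v; rewrite inE => vA; have [iso|[t evt]] := iso_or v.
    exact: absorbs_isolated.
  apply: (absE _ _ _ _ xA vA yA exy); apply/eqP; apply: contraNT noe => dv.
  by apply/existsP; exists v; apply/existsP; exists t; rewrite evt.
have dxy v : v \in A -> d v = d x.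
  by rewrite !inE => /orP [] /eqP -> //; move: exy; rewrite eE => /and3P [_ /eqP ->].
clearbody A.
have dxy' : d x' = d y' by move: exy'; rewrite eE => /and3P [_ /eqP].
have x'A : x' \notin A by apply: contra dx' => /dxy ->.
have y'A : y' \notin A by apply: contra dx' => /dxy; rewrite dxy' => ->.
have [|P' rP'] := add_edge rP x'A y'A exy'.
  move=> v vA; have dv : (d x' == d v) = false by rewrite (dxy v vA) (negbTE dx').
  by rewrite !eE -dxy' dv !andbF.
apply: (saturate_from rP'); last 1 first.
- have c4 : (#|y' |: (x' |: A)| <= 4)%N.
    rewrite cardsU1; apply: (@leq_add _ _ 1 3); first exact: leq_b1.
    by rewrite cardsU1; apply: (@leq_add _ _ 1 2); first exact: leq_b1.
  by apply: leq_trans (leq_add c4 (leqnn s)) _; lia.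
- move=> v; rewrite inE => vA; have [iso|[t evt]] := iso_or v.
    exact: absorbs_isolated.
  have [dvx|dvx] := eqVneq (d v) (d x).
    by apply: (absE _ x _ y) => //; rewrite !inE ?xA ?yA !orbT.
  apply: (absE _ x' _ y') => //; rewrite ?(in_setU1 y', in_setU1 x', eqxx, orbT) //.
  (* three different values other than None are impossible *)
  move: evt exy exy' dvx dx'; rewrite !eE.
  move=> /and3P [_ _ dv] /and3P [_ _ d1] /and3P [_ _ d2]; move: dv d1 d2.
  by case: (d v) => [[]|] //; case: (d x) => [[]|] //; case: (d x') => [[]|].
- exact: s2.
Qed.

End Clusters.

(** * Graphs given by vertex classes *)

Section Classes.
Variables (R : realType) (n k : nat) (e : rel 'I_n).

(** Vertex classes: [None] for the isolated vertices, [Some None] for those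
    adjacent to all but these, and [Some (Some (i, t))] for the side [t] of the
    [i]-th pair of cliques.  [codj] tells whether distinct vertices of the given
    classes are adjacent in the complement of the graph. *)
Definition codj (c c' : option (option ('I_k * bool))) : bool :=
  match c, c' with
  | None, _ | _, None => true
  | Some (Some (i, s)), Some (Some (j, s')) => (i == j) && (s != s')
  | _, _ => false
  end.

Lemma codjC c c' : codj c c' = codj c' c.
Proof. by case: c c' => [[[i s]|]|] [[[j t]|]|] //=; rewrite eq_sym [s == t]eq_sym. Qed.

Variable c : 'I_n -> option (option ('I_k * bool)).
Hypothesis eE : forall x y, e x y = (x != y) && ~~ codj (c x) (c y).
Hypothesis c_surj : forall i s, exists x, c x = Some (Some (i, s)).
Hypothesis c_apex : k = 1%N -> forall z, c z = Some None ->
  exists2 z', z' != z & c z' = Some None.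

Let e_sym : symmetric e.
Proof. by move=> x y; rewrite !eE eq_sym codjC. Qed.

Let e_irr : irreflexive e.
Proof. by move=> x; rewrite eE eqxx. Qed.

Let eN x y : ~~ codj (c x) (c y) -> c x != c y -> e x y.
Proof. by move=> ncxy cxy; rewrite eE ncxy andbT; apply: contraNneq cxy => ->. Qed.

Let absE (A : {set 'I_n}) x y z : x \in A -> y \notin A -> z \in A -> e x z ->
  c y = c x ->
  absorbs e A y.
Proof.
move=> xA yA zA exz cyx; apply: (absorbs_twin xA zA exz).
  rewrite eE cyx; apply/andP; split; first by apply: contraNneq yA => <-.
  move: exz; rewrite eE => /andP [_]; case: (c x) => [[[i s]|]|] //= _.
  by rewrite !eqxx.
by move=> v vx vy; rewrite !eE cyx ![_ == v]eq_sym vx vy.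
Qed.

Let abs_isolated (A : {set 'I_n}) y : c y = None -> absorbs e A y.
Proof. by move=> cy; apply: absorbs_isolated => v; rewrite eE cy andbF. Qed.

(** Keep one representative of every class: the ranks [2] to [k] are obtained
    there, and saturation reaches the ranks up to [k] plus the number of remaining
    vertices.  The higher ranks are complementary to ranks that are at most [k]. *)
Lemma many_classes_realize s : (1 < k)%N -> (1 < s)%N -> (s + 2 <= n)%N ->
  exists P : 'M[R]_n, realizes e [set: 'I_n] P s.
Proof.
move=> k2 s2 sn.
have ex p : exists x, c x = Some (Some p) by case: p => i t; apply: c_surj.
have [rep repP] := fin_all_exists ex.
have k0 := ltnW k2.
pose ik i : 'I_k := insubd (Ordinal k0) i.
have ikE i : (i < k)%N -> ik i = i :> nat by move=> lt; rewrite val_insubd lt.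
pose a i := rep (ik i, false); pose b i := rep (ik i, true).
have ikN i j : (i < k)%N -> (j < k)%N -> i != j -> (ik i == ik j) = false.
  by move=> lti ltj ij; rewrite -val_eqE /= !ikE // (negbTE ij).
have ca i : c (a i) = Some (Some (ik i, false)) := repP _.
have cb i : c (b i) = Some (Some (ik i, true)) := repP _.
have ab_neq i : (i < k)%N -> a i != b i.
  by move=> _; apply/eqP => /(congr1 c); rewrite ca cb.
have ab_nadj i : (i < k)%N -> ~~ e (a i) (b i) by rewrite eE ca cb /= eqxx andbF.
have ps (Z : {set 'I_n}) : {in Z, forall z, c z = Some None} ->
    pair_system e Z a b k.
  move=> ZN; split=> // [i j lti ltj ij|i j lti ltj ij|i j lti ltj ij|z zZ i lti].
  - have ikij := ikN _ _ lti ltj ij.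
    by apply: eN; rewrite !ca /= ?ikij //; apply/eqP => -[/eqP]; rewrite ikij.
  - have ikij := ikN _ _ lti ltj ij.
    by apply: eN; rewrite ca cb /= ?ikij //; apply/eqP => -[].
  - have ikij := ikN _ _ lti ltj ij.
    by apply: eN; rewrite !cb /= ?ikij //; apply/eqP => -[/eqP]; rewrite ikij.
  - by apply/andP; split; apply: eN; rewrite (ZN z zZ) ?ca ?cb.
have absp (Z : {set 'I_n}) : {in Z, forall z, c z = Some None} ->
    ((exists z, z \in Z) \/ forall z, c z != Some None) ->
    {in ~: pairset Z a b k, forall y, absorbs e (pairset Z a b k) y}.
  move=> ZN Zdom y; rewrite inE => yA; have psZ := ps Z ZN.
  have aA i : (i < k)%N -> a i \in pairset Z a b k.
    by move=> lt; rewrite mem_pairset.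
  have bA i : (i < k)%N -> b i \in pairset Z a b k.
    by move=> lt; rewrite mem_pairset.
  case cy : (c y) => [[[i t]|]|]; last exact: abs_isolated.
    (* a vertex of another pair is a neighbour of both representatives *)
    pose j := (i == 0 :> nat)%N : nat.
    have ji : i != j :> nat by rewrite /j; case: (nat_of_ord i).
    have jk : (j < k)%N by rewrite /j; case: eqP.
    have iki : ik i = i by apply/val_inj; rewrite /= ikE.
    case: t cy => cy.
      apply: (absE (bA i _) yA (bA j _)) => //; last by rewrite cy cb iki.
      by apply: (pair_bb psZ).
    apply: (absE (aA i _) yA (aA j _)) => //; last by rewrite cy ca iki.
    by apply: (pair_aa psZ).
  case: Zdom => [[z zZ]|/(_ y)]; last by rewrite cy eqxx.
  have zA : z \in pairset Z a b k by apply/in_pairset; left.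
  apply: (absE zA yA (aA 0%N _)) => //; last by rewrite cy ZN.
  by apply: eN; rewrite (ZN z zZ) ca.
have main (Z : {set 'I_n}) : {in Z, forall z, c z = Some None} ->
    ((exists z, z \in Z) \/ forall z, c z != Some None) -> (#|Z| <= 1)%N ->
    (forall r, (1 < r <= k)%N ->
       exists P : 'M[R]_n, realizes e (pairset Z a b k) P r) ->
    exists P : 'M[R]_n, realizes e [set: 'I_n] P s.
  move=> ZN Zdom Z1 real.
  have cA := leq_trans (card_pairset Z a b k) (leq_add Z1 (leqnn _)).
  have cn : (#|pairset Z a b k| <= n)%N by rewrite -[X in (_ <= X)%N]card_ord max_card.
  have small r : (1 < r <= k)%N -> exists P : 'M[R]_n, realizes e [set: 'I_n] P r.
    move=> rk; have [P rP] := real r rk.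
    by apply: (saturate_from e_sym e_irr rP (absp Z ZN Zdom)); rewrite // leq_add2r.
  have [sk|ks] := leqP s k; first by apply: small; rewrite s2.
  have [big|lt] := leqP (#|pairset Z a b k| + s) (n + k).
    have [|P rP] := real k; first by rewrite k2 leqnn.
    by apply: (saturate_from e_sym e_irr rP (absp Z ZN Zdom)); rewrite // ltnW.
  have lt' := leq_trans lt (leq_add cA (leqnn s)).
  have [|P rP] := small (n - s)%N; first by apply/andP; split; lia.
  exists (1%:M - P); have -> : s = (n - (n - s))%N by lia.
  by apply: realizes_compl rP; apply: leq_subr.
have [/existsP [z /eqP cz]|nodom] := boolP [exists z, c z == Some None].
  apply: (main [set z]).
  - by move=> v; rewrite inE => /eqP ->.
  - by left; exists z; rewrite inE.
  - by rewrite cards1.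
  - move=> r; apply: cone_realizes => //; apply: ps => v.
    by rewrite inE => /eqP ->.
apply: (main set0).
- by move=> v; rewrite inE.
- by right; apply/forallP; rewrite -negb_exists.
- by rewrite cards0.
- move=> r; apply: cocktail_party_realizes => //; apply: ps => v.
  by rewrite inE.
Qed.

Lemma classes_realize s : (1 < s)%N -> (s + 2 <= n)%N ->
  exists P : 'M[R]_n, realizes e [set: 'I_n] P s.
Proof.
move=> s2 sn; have [k2|k1] := ltnP 1 k; first exact: many_classes_realize.
have oneclass (i j : 'I_k) : i = j.
  by apply/val_inj => /=; have := ltn_ord i; have := ltn_ord j; lia.
have cluster : (k = 0%N \/ forall z, c z <> Some None) ->
    exists P : 'M[R]_n, realizes e [set: 'I_n] P s.
  move=> k0; pose d x := match c x with
    | Some (Some (_, t)) => Some t | Some None => Some true | None => None end.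
  apply: (cluster_realizes R e_sym e_irr (d := d)) => // x y.
  rewrite eE /d; congr (_ && _).
  case cx : (c x) => [[[i t]|]|]; case cy : (c y) => [[[j t']|]|] //=.
  - by rewrite (oneclass i j) eqxx /= negbK andbT.
  - by case: k0 => [k0|/(_ y)] //; have := ltn_ord i; rewrite {2}k0.
  - by case: k0 => [k0|/(_ x)] //; have := ltn_ord j; rewrite {2}k0.
have [/existsP [z /eqP cz]|nodom] := boolP [exists z, c z == Some None]; last first.
  apply: cluster; right => z /eqP cz; move/negP: nodom; apply.
  by apply/existsP; exists z.
have [k0|kpos] := posnP k; first by apply: cluster; left.
have [|z' z'z cz'] := c_apex _ cz; first by apply/eqP; rewrite eqn_leq k1.
have [a ca] := c_surj (Ordinal kpos) false; have [b cb] := c_surj (Ordinal kpos) true.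
have ezz' : e z z' by rewrite eE eq_sym z'z cz cz'.
have eza : e z a by apply: eN; rewrite cz ca.
have ezb : e z b by apply: eN; rewrite cz cb.
have ez'a : e z' a by apply: eN; rewrite cz' ca.
have ez'b : e z' b by apply: eN; rewrite cz' cb.
have ab : a != b by apply/eqP => /(congr1 c); rewrite ca cb.
have nab : ~~ e a b by rewrite eE ca cb /= ?eqxx andbF.
have [P rP] := base_double_cone R e_sym e_irr ezz' eza ezb ez'a ez'b ab nab.
apply: (saturate_from e_sym e_irr rP) => //; last first.
  have c4 : (#|[set v in [:: z; z'; a; b]]| <= 4)%N by rewrite cardsE; apply: card_size.
  by apply: leq_trans (leq_add c4 (leqnn s)) _; lia.
move=> y; rewrite inE => yA.
case cy : (c y) => [[[i t]|]|]; last exact: abs_isolated.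
  rewrite (oneclass i (Ordinal kpos)) in cy; case: t cy => cy.
    by apply: (absE (x := b) (z := z)) => //; rewrite ?inE ?eqxx ?orbT // ?cy // e_sym.
  by apply: (absE (x := a) (z := z)) => //; rewrite ?inE ?eqxx ?orbT // ?cy // e_sym.
by apply: (absE (x := z) (z := z')) => //; rewrite ?inE ?eqxx ?orbT // cy.
Qed.
End Classes.

(** * From projections to the theorem *)

Section Spectrum.
Variables (R : realType) (n : nat).
Implicit Types P : 'M[R]_n.

Lemma eigen_mult0_proj P s : proj P s -> eigen_mult P 0 = (n - s)%N.
Proof.
by move=> pP; rewrite /eigen_mult /eigenspace raddf0 subr0 mxrank_ker (mxrank_proj pP).
Qed.

Lemma eigen_mult1_proj P s : (s <= n)%N -> proj P s -> eigen_mult P 1 = s.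
Proof.
move=> sn pP; rewrite /eigen_mult /eigenspace mxrank_ker -opprB mxrank_opp.
by rewrite (mxrank_proj (proj_compl sn pP)) subKn.
Qed.

Lemma eigenvalue_proj P s (a : R) : proj P s -> (0 < s < n)%N ->
  eigenvalue P a <-> a = 1 \/ a = 0.
Proof.
move=> pP /andP [s0 sn]; split.
  case/eigenvalueP => v vP v0; have [_ iP _] := pP.
  have E : a *: v = (a * a) *: v.
    by rewrite -[in LHS]vP -[in LHS]iP mulmxA vP -scalemxAl vP scalerA.
  have : (a * a - a) *: v == 0 by rewrite scalerBl -E subrr.
  rewrite scaler_eq0 (negbTE v0) orbF -[X in _ - X]mulr1 -mulrBr mulf_eq0 subr_eq0.
  by case/orP => /eqP ->; [right|left].
have H b : (0 < eigen_mult P b)%N -> eigenvalue P b.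
  by rewrite /eigen_mult /eigenvalue lt0n mxrank_eq0.
case=> ->; apply: H; first by rewrite (eigen_mult1_proj _ pP) // ltnW.
by rewrite (eigen_mult0_proj pP) subn_gt0.
Qed.
End Spectrum.

Section Model.
Variables (p0 k r : nat) (p q : 'I_k -> nat).

Local Notation model := (gjoin (gunion (complete_bipartite p0 0)
   (gbigunion (fun i : 'I_k => complete_bipartite (p i) (q i)))) (complete r)).

Definition model_class
    (t : (('I_p0 + 'I_0) + {i : 'I_k & ('I_(p i) + 'I_(q i))%type}) + 'I_r) :
    option (option ('I_k * bool)) :=
  match t with
  | inl (inl _) => Some None
  | inl (inr u) =>
      Some (Some (tag u, match tagged u with inl _ => false | inr _ => true end))
  | inr _ => None
  end.

(** Up to equality of vertices, adjacency in the complement of [G] only depends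
    on the classes. *)
Lemma model_adjE t t' : t != t' ->
  adj model t t' = codj (model_class t) (model_class t').
Proof.
case: t t' => [[[u|[? //]]|[i u]]|u] [[[v|[? //]]|[j v]]|v] //=.
move=> _; rewrite /bigunion_adj /=; case: eqP => //= ij; case: _ / ij v => v.
by rewrite tagged_asE; case: u v => u [] v.
Qed.
End Model.

Lemma ord_other m (i : 'I_m) : m != 1%N -> exists j : 'I_m, j != i.
Proof.
case: m i => [[] //|[|m]] // i _.
by have [->|i0] := eqVneq i ord0; [exists ord_max | exists ord0; rewrite eq_sym].
Qed.

Theorem theorem4p2 (R : realType) (p0 k r : nat) (p q : 'I_k -> nat)
    (n : nat) (G : sgraph 'I_n)
    (hp0k : (p0, k) <> (1%N, 1%N))
    (hp : forall i, (0 < p i)%N) (hq : forall i, (0 < q i)%N)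
    (hG : sgraph_iso (compl G)
            (gjoin (gunion (complete_bipartite p0 0)
                           (gbigunion (fun i : 'I_k =>
                              complete_bipartite (p i) (q i))))
                   (complete r)))
    (n1 n2 : nat) (hn : (4 + n1 + n2)%N = n) :
  exists (A : 'M[R]_n) (lambda mu : R),
    [/\ in_S G A,
        lambda != mu,
        (forall a : R, eigenvalue A a <-> a = lambda \/ a = mu),
        eigen_mult A lambda = (2 + n1)%N
      & eigen_mult A mu = (2 + n2)%N].
Proof.
have [f [[g fK gK] fadj]] := hG.
pose c x := model_class (f x).
have eE x y : adj G x y = (x != y) && ~~ codj (c x) (c y).
  have [-> | xy] := eqVneq x y; first by rewrite adj_irr.
  have fxy : f x != f y by rewrite (can_eq fK).
  by rewrite -(model_adjE fxy) fadj /= /compl_adj xy negbK.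
have c_surj i s : exists x, c x = Some (Some (i, s)).
  pose u : ('I_(p i) + 'I_(q i))%type :=
    if s then inr (Ordinal (hq i)) else inl (Ordinal (hp i)).
  exists (g (inl (inr (Tagged (fun i => ('I_(p i) + 'I_(q i))%type) u)))).
  by rewrite /c gK /= /u; case: s u.
have c_apex : k = 1%N -> forall z, c z = Some None ->
    exists2 z', z' != z & c z' = Some None.
  move=> k1 z; rewrite /c; case fz : (f z) => [[[i|[? //]]|]|] //= _.
  have [|j ji] := @ord_other _ i.
    by apply/eqP => p01; apply: hp0k; rewrite p01 k1.
  exists (g (inl (inl (inl j)))); last by rewrite gK.
  by apply: contraNneq ji => zE; move: fz; rewrite -zE gK => -[->].
have [||P rP] := classes_realize R eE c_surj c_apex (s := 2 + n1); [lia|lia|].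
have pP := real_proj rP.
have sn : (0 < 2 + n1 < n)%N by apply/andP; split; lia.
exists P, 1, 0; split.
- split; first by case: pP.
  by move=> i j ij; apply: (real_adj rP); rewrite ?inE.
- exact: oner_neq0.
- by move=> a; apply: eigenvalue_proj pP sn.
- by apply: eigen_mult1_proj pP; lia.
- by rewrite (eigen_mult0_proj pP); lia.
Qed.
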